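(* Let $E$ be a locally compact Polish space. Let $\Theta,\Xi$ be independent point processes on $E$ with $\Theta$ of type $\mathcal{C}_{non\text{-}vanishing}$ and $\Xi$ of type $\mathcal{C}_{zero}$, and let $\Theta',\Xi'$ be another independent pair with $\Theta'$ of type $\mathcal{C}_{non\text{-}vanishing}$ and $\Xi'$ of type $\mathcal{C}_{zero}$. If $\Theta+\Xi\stackrel{d}{=}\Theta'+\Xi'$, then $\Theta\stackrel{d}{=}\Theta'$ and $\Xi\stackrel{d}{=}\Xi'$. That is, the independent superposition $\Theta+\Xi$ determines uniquely the distributions of $\Theta$ and of $\Xi$.
   Context: A point process on $E$ is a random Radon measure on $E$ with values in $\mathbb{N}\cup\{\infty\}$; the sum of independent point processes is the sum of the random measures. $\mathcal{B}_c(E)$ is the set of bounded Borel functions $\varphi:E\to\mathbb{C}$ with compact support. $\mathcal{C}$ is the class of point processes $\Lambda$ on $E$ for which the probability generating functional $\mathscr{B}_\Lambda(\varphi)=\mathbb{E}\big(\prod_{x\in E}(1+\varphi(x))^{\Lambda(\{x\})}\big)$ is well defined for all $\varphi\in\mathcal{B}_c(E)$; equivalently $\mathbb{E}(a^{\Lambda(B)})<\infty$ for every relatively compact Borel $B\subset E$ and every $a>0$. For $\Lambda\in\mathcal{C}$ and $\varphi\in\mathcal{B}_c(E)$, $z\mapsto\mathscr{B}_\Lambda(z\varphi)$ is entire. $\mathcal{C}_{non\text{-}vanishing}$ is the subclass of $\Theta\in\mathcal{C}$ such that for every $\varphi\in\mathcal{B}_c(E)$ the entire function $z\mapsto\mathscr{B}_\Theta(z\varphi)$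 has no zeros in $\mathbb{C}$. $\mathcal{C}_{zero}$ is the subclass of $\Xi\in\mathcal{C}$ such that for every $\varphi\in\mathcal{B}_c(E)$ the entire function $z\mapsto\mathscr{B}_\Xi(z\varphi)$ is uniquely determined by its zeros (counted with multiplicity), understood as: if $\Xi,\Xi'$ are of type $\mathcal{C}_{zero}$ and for some $\varphi$ the functions $z\mapsto\mathscr{B}_\Xi(z\varphi)$ and $z\mapsto\mathscr{B}_{\Xi'}(z\varphi)$ have the same zeros with multiplicities, then these two functions coincide. *)

(* Defs.v *)
From HB Require Import structures.
From mathcomp Require Import all_boot all_order all_algebra.
From mathcomp Require Import all_classical all_reals all_analysis.
From mathcomp Require Import measurable_realfun complex.
Set Implicit Arguments. Unset Strict Implicit. Unset Printing Implicit Defensive.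
Import Order.TTheory GRing.Theory Num.Theory.
Import numFieldNormedType.Exports.
Local Open Scope classical_set_scope.
Local Open Scope ring_scope.

Section PointProcesses.
Variables (R : realType) (E : completePseudoMetricType R).

Definition Borel : Type := g_sigma_algebraType (@open E).

(** A (counting) measure on E is represented by its set function. *)
Definition cfg : Type := set E -> \bar R.

Definition is_measure_fun (mu : cfg) : Prop :=
  [/\ mu set0 = 0%E,
      (forall A : set Borel, measurable A -> (0 <= mu A)%E)
    & semi_sigma_additive (mu : set Borel -> \bar R)].

Definition cfg_gen : set (set cfg) :=
  [set S | exists (A : set Borel) (U : set (\bar R)),
      [/\ measurable A, measurable U & S = (fun mu : cfg => mu A) @^-1` U]].

Definition cfg_measurable : set (set cfg) := <<s cfg_gen >>.

Section OnProbabilitySpace.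
Variables (d : measure_display) (Omega : measurableType d)
          (P : probability Omega R).

Definition point_process (L : Omega -> cfg) : Prop :=
  [/\ forall w, is_measure_fun (L w),
      forall w (A : set Borel), measurable A ->
        (exists n : nat, L w A = (n%:R)%:E) \/ L w A = +oo%E,
      forall w (K : set E), compact K -> (L w K < +oo)%E
    & forall A : set Borel, measurable A ->
        measurable_fun [set: Omega] (fun w => L w A)].

Definition pp_add (L1 L2 : Omega -> cfg) : Omega -> cfg :=
  fun w A => (L1 w A + L2 w A)%E.

Definition pp_indep (L1 L2 : Omega -> cfg) : Prop :=
  forall S1 S2, cfg_measurable S1 -> cfg_measurable S2 ->
    P (L1 @^-1` S1 `&` L2 @^-1` S2) = (P (L1 @^-1` S1) * P (L2 @^-1` S2))%E.

End OnProbabilitySpace.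

Definition eq_in_law d (Omega : measurableType d) (P : probability Omega R)
    (L : Omega -> cfg) d' (Omega' : measurableType d')
    (P' : probability Omega' R) (L' : Omega' -> cfg) : Prop :=
  forall S, cfg_measurable S -> P (L @^-1` S) = P' (L' @^-1` S).

Definition Bc (phi : E -> R[i]) : Prop :=
  [/\ exists M : R, forall x, `|phi x| <= (M%:C)%C,
      measurable_fun [set: Borel] (fun x : Borel => complex.Re (phi x)),
      measurable_fun [set: Borel] (fun x : Borel => complex.Im (phi x))
    & compact (closure [set x | phi x != 0])].

Definition atom_mult (mu : cfg) (x : E) : nat := Num.truncn (fine (mu [set x])).

(** prod_{x in E} (1 + phi x)^(mu {x})  (finitely many non-trivial factors) *)
Definition pgfl_integrand (mu : cfg) (phi : E -> R[i]) : R[i] :=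
  \big[*%R/1%R]_(x \in [set: E]) (1 + phi x) ^+ atom_mult mu x.

Section PGFL.
Variables (d : measure_display) (Omega : measurableType d)
          (P : probability Omega R).

Definition pgfl (L : Omega -> cfg) (phi : E -> R[i]) : R[i] :=
  Complex
    (Rintegral P [set: Omega] (fun w => complex.Re (pgfl_integrand (L w) phi)))
    (Rintegral P [set: Omega] (fun w => complex.Im (pgfl_integrand (L w) phi))).

Definition class_C (L : Omega -> cfg) : Prop :=
  forall phi, Bc phi ->
    P.-integrable [set: Omega]
        (fun w => (complex.Re (pgfl_integrand (L w) phi))%:E) /\
    P.-integrable [set: Omega]
        (fun w => (complex.Im (pgfl_integrand (L w) phi))%:E).

Definition class_C_nonvanishing (L : Omega -> cfg) : Prop :=
  class_C L /\
  forall phi, Bc phi -> forall z : R[i], pgfl L (fun x => z * phi x) != 0.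

End PGFL.

Definition zero_of_order (f : R[i] -> R[i]) (z0 : R[i]) (m : nat) : Prop :=
  exists g : R[i] -> R[i],
    [/\ forall e : R, 0 < e -> exists2 del : R, 0 < del &
          forall z, `|z - z0| < (del%:C)%C -> `|g z - g z0| < (e%:C)%C,
        g z0 != 0
      & forall z, f z = (z - z0) ^+ m * g z].

(** The C_zero property for the pair (Xi, Xi'): whenever, for some phi,
    z |-> B_Xi(z phi) and z |-> B_Xi'(z phi) have the same zeros counted
    with multiplicity, these two functions coincide. *)
Definition zeros_determine d (Omega : measurableType d) (P : probability Omega R)
    (L : Omega -> cfg) d' (Omega' : measurableType d')
    (P' : probability Omega' R) (L' : Omega' -> cfg) : Prop :=
  forall phi, Bc phi ->
    (forall z0 m,
       zero_of_order (fun z => pgfl P L (fun x => z * phi x)) z0 m <->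
       zero_of_order (fun z => pgfl P' L' (fun x => z * phi x)) z0 m) ->
    forall z, pgfl P L (fun x => z * phi x) = pgfl P' L' (fun x => z * phi x).

End PointProcesses.

(* Main.v *)
(** Fix Borel sets A_1, ..., A_k inside a compact K and weights s_i > 0, and
    take phi = prod_i s_i^(1_(A_i)) - 1, which has finite range.  Since an
    integer-valued Radon measure is a sum of its atoms, the integrand of
    B_L(z phi) is a finite product of powers (1 + z v)^(L(phi = v)), and at
    z = 1 it is prod_i s_i^(L(A_i)).  Independence and equality in law give
    B_Theta(z phi) B_Xi(z phi) = B_Theta'(z phi) B_Xi'(z phi) for all z.
    Since z |-> B_Theta(z phi) and z |-> B_Theta'(z phi) are continuous and never
    vanish, B_Xi(z phi) and B_Xi'(z phi) have the same zeros with
    multiplicities, hence coincide; at z = 1 their common value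
    E prod_i s_i^(Xi(A_i)) is positive and can be cancelled.  The means
    E prod_i s_i^(L(A_i)), s_i in ]0, 1], determine the joint law of the
    L(A_i), and an exhaustion of E by compact sets followed by a pi-lambda
    argument yields the law of L. *)

Require Import Defs.
From HB Require Import structures.
From mathcomp Require Import all_boot all_order all_algebra.
From mathcomp Require Import all_classical all_reals all_analysis.
From mathcomp Require Import measurable_realfun complex ring lra.
Import Order.TTheory GRing.Theory Num.Theory.
Import numFieldNormedType.Exports.
Local Open Scope classical_set_scope.
Local Open Scope ring_scope.
Set Implicit Arguments. Unset Strict Implicit. Unset Printing Implicit Defensive.

(** * Atoms of integer-valued measures *)

Section PatchedMeasure.
Context {R : realType} {E : completePseudoMetricType R} (mu : cfg E).
Hypothesis mu_meas : is_measure_fun mu.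

(* [is_measure_fun] says nothing about non-measurable sets, whereas a library
   measure is nonnegative on all sets. *)
Definition patch_measure (A : set (Borel E)) : \bar R :=
  if `[< measurable A >] then mu A else 0%E.

Lemma patch_measureE (A : set (Borel E)) :
  measurable A -> patch_measure A = mu A.
Proof. by rewrite /patch_measure => /asboolT ->. Qed.

Let patch0 : patch_measure set0 = 0%E.
Proof. by have [mu0 _ _] := mu_meas; rewrite patch_measureE. Qed.

Let patch_ge0 A : (0 <= patch_measure A)%E.
Proof.
have [_ mu_ge0 _] := mu_meas; rewrite /patch_measure.
by case: asboolP => [mA|_]; [exact: mu_ge0|exact: lexx].
Qed.

Let patch_sigma_additive : semi_sigma_additive patch_measure.
Proof.
have [_ _ mu_sigma] := mu_meas; move=> F mF tF mUF.
rewrite patch_measureE//.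
by under eq_fun do under eq_bigr do rewrite patch_measureE//; exact: mu_sigma.
Qed.

HB.instance Definition _ :=
  isMeasure.Build _ _ _ patch_measure patch0 patch_ge0 patch_sigma_additive.

Lemma is_measure_fun_measure : exists m : {measure set Borel E -> \bar R},
  forall A : set (Borel E), measurable A -> m A = mu A.
Proof. by exists patch_measure => A; exact: patch_measureE. Qed.

End PatchedMeasure.

Section Atoms.
Context {R : realType} {E : completePseudoMetricType R}.
Hypothesis E_hausdorff : hausdorff_space E.
Hypothesis E_second_countable : @second_countable E.

Lemma open_borel (A : set E) : open A -> measurable (A : set (Borel E)).
Proof. exact: sub_sigma_algebra. Qed.

Lemma closed_borel (A : set E) : closed A -> measurable (A : set (Borel E)).
Proof.
move=> cA; rewrite -(setCK A); apply: measurableC.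
by apply: open_borel; exact: closed_openC.
Qed.

Lemma set1_borel (x : E) : measurable ([set x] : set (Borel E)).
Proof.
apply: closed_borel; apply: accessible_closed_set1; exact: hausdorff_accessible.
Qed.

Lemma set_seq_cons (x : E) s : [set` x :: s] = [set x] `|` [set` s].
Proof.
apply/seteqP; split=> y /=; rewrite inE.
  by case/orP=> [/eqP ->|ys]; [left|right].
by case=> [->|ys]; [rewrite eqxx|apply/orP; right].
Qed.

Lemma seq_borel (s : seq E) : measurable ([set` s] : set (Borel E)).
Proof.
elim: s => [|x s IHs]; first by rewrite set_nil; exact: measurable0.
rewrite set_seq_cons; apply: measurableU => //; exact: set1_borel.
Qed.

(** An enumerated base lets the atom search refine a set one basic open set at a time. If the given
    base is empty, no point has a basic neighbourhood, so [E] has no points and any sequence of open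
    sets will do. *)
Lemma countable_base : exists U : nat -> set E, (forall n, open (U n)) /\
  forall x V, nbhs x V -> exists2 n, U n x & U n `<=` V.
Proof.
case: E_second_countable => B cB [Bopen Bbasis].
case/pfcard_geP: cB => [B0|[f]].
  exists (fun=> set0); split=> [n|x V xV]; first exact: open0.
  by case: (Bbasis x V xV) => W [+ _] _; rewrite B0.
exists (fun n => f n); split=> [n|x V xV].
  by apply: Bopen; exact: funS.
case: (Bbasis x V xV) => W [BW Wx] WV.
by have [n _ fnW] := @surj _ _ _ _ f W BW; exists n; rewrite fnW.
Qed.

Section IntegerMeasure.
Variables (m : {measure set Borel E -> \bar R}) (K : set (Borel E)).
Hypothesis mK : measurable K.
Hypothesis K_fin : (m K < +oo)%E.
Hypothesis m_int : forall B : set (Borel E), measurable B -> B `<=` K ->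
  exists n : nat, m B = n%:R%:E.

(* Halving along a countable base keeps an integer mass >= 1 and shrinks the
   set to at most one point. *)
Lemma exists_atom (A : set (Borel E)) : measurable A -> A `<=` K -> m A != 0%E ->
  exists2 x, A x & m [set x] != 0%E.
Proof.
move=> mA AK A0; have [U [Uopen Ubase]] := countable_base.
pose step n B := if m (B `&` U n) == 0%E then B `\` U n else B `&` U n.
pose F := fix F n : set (Borel E) := if n is k.+1 then step k (F k) else A.
have mU n : measurable (U n : set (Borel E)) by exact: open_borel.
have FP n : [/\ measurable (F n), F n `<=` K & m (F n) != 0%E].
  elim: n => [//|n [mF FK F0]] /=; rewrite /step.
  case: ifPn => mFU; split=> //; do ?[exact: measurableD|exact: measurableI];
    do ?[by move=> x [? _]; exact: FK].
  by move: F0; rewrite (measureDI m mF (mU n)) [X in (_ + X)%E](eqP mFU) adde0.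
have Fdecr n : F n.+1 `<=` F n.
  by rewrite /= /step; case: ifPn => _ x [].
have FA n : F n `<=` A by elim: n => // n IHn; apply: subset_trans IHn.
have mcap : measurable (\bigcap_n F n).
  by apply: bigcap_measurableType => n _; case: (FP n).
(* Each [F n] has a nonzero integer mass, hence mass at least 1. Continuity from above, available
   since [m K] is finite, carries this bound to the intersection. *)
have m1 : (1 <= m (\bigcap_n F n))%E.
  have cvgF : m (F n) @[n --> \oo] --> m (\bigcap_n F n).
    apply: nonincreasing_cvg_mu => //.
    - by rewrite (le_lt_trans _ K_fin)// le_measure// inE.
    - by move=> n; case: (FP n).
    - by apply/nonincreasing_seqP => n; exact/subsetPset.
  rewrite -(cvg_lim _ cvgF)//; apply: lime_ge; first by apply: cvgP cvgF.
  near=> n; have [mF FK F0] := FP n.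
  have [[|k] mk] := m_int mF FK; first by exfalso; move: F0; rewrite mk => /eqP; apply.
  by rewrite mk lee_fin ler1n.
have [cap0|/set0P[x Fx]] := eqVneq (\bigcap_n F n) set0.
  by move: m1; rewrite cap0 measure0 lee_fin ler10.
have capE : \bigcap_n F n = [set x].
  apply/seteqP; split=> [y Fy|_ ->//]; apply: contrapT => /eqP yx.
  (* Some [U n] contains y and misses x, whereas [F n.+1] is either inside [U n] or disjoint from
     it, so it cannot contain both points. *)
  move: E_hausdorff; rewrite open_hausdorff => /(_ y x yx)[[V W]/= [Vy Wx] [oV oW /eqP VW]].
  rewrite !inE in Vy Wx.
  have [n Uny UnV] := Ubase y V (open_nbhs_nbhs (conj oV Vy)).
  have [] := (Fy n.+1 I, Fx n.+1 I); rewrite /= /step; case: ifPn => _ [_ Uy] [_ Ux].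
    exact: Uy.
  have : (V `&` W) x by split=> //; exact: UnV.
  by rewrite VW.
exists x; first exact: (FA 0%N _ (Fx 0%N I)).
rewrite -capE; apply/eqP => m0; move: m1.
by rewrite m0 lee_fin ler10.
Unshelve. all: by end_near. Qed.

Lemma measure_seq (s : seq E) : uniq s ->
  m [set` s] = (\sum_(x <- s) m [set x])%E.
Proof.
elim: s => [|x s IHs] /=; first by rewrite big_nil set_nil measure0.
move=> /andP[xs us]; rewrite big_cons set_seq_cons measureU.
- by rewrite -IHs.
- exact: set1_borel.
- exact: seq_borel.
- by rewrite -subset0 => y [-> /=]; rewrite (negPf xs).
Qed.

(** Strong induction on the mass: removing one atom, of integer mass at least 1, strictly lowers it,
    so the search stops after finitely many atoms. *)
Lemma exists_atoms n (A : set (Borel E)) : measurable A -> A `<=` K ->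
  m A = n%:R%:E ->
  exists s : seq E, [/\ uniq s, [set` s] `<=` A & m (A `\` [set` s]) = 0%E].
Proof.
elim/ltn_ind: n A => -[_ A mA AK mA0|n IHn A mA AK mAn].
  by exists [::]; split=> //; rewrite set_nil setD0.
have [|x Ax mx0] := exists_atom mA AK; first by rewrite mAn eqe pnatr_eq0.
have mx := set1_borel x.
have xK : [set x] `<=` K by move=> _ ->; exact: AK.
have [[|k] mxk] := m_int mx xK; first by rewrite mxk eqxx in mx0.
have mAx : measurable (A `\ x) by exact: measurableD.
have AxK : A `\ x `<=` K by move=> y [/AK].
have [j mj] := m_int mAx AxK.
have nE : n.+1 = (j + k.+1)%N.
  have mE : (n.+1%:R%:E = j%:R%:E + k.+1%:R%:E :> \bar R)%E.
    rewrite -mAn (measureDI m mA mx) -mj -mxk; congr (_ + m _)%E.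
    by apply/setIidr => _ ->.
  by move: mE; rewrite -EFinD -natrD => -[] /eqP; rewrite eqr_nat => /eqP.
have [|s [us sA ms]] := IHn j _ _ mAx AxK mj.
  by rewrite nE addnS ltnS leq_addr.
exists (x :: s); split=> /=.
- rewrite us andbT; apply/negP => xs.
  by case: (sA x xs) => _ /=; apply.
- by rewrite set_seq_cons => y [->//|/sA[]].
- by rewrite set_seq_cons -setDDl.
Qed.

End IntegerMeasure.

End Atoms.

(** * Multiplicities of a single configuration *)

Definition counting {R : realType} {E : completePseudoMetricType R}
    (mu : cfg E) : Prop :=
  [/\ is_measure_fun mu,
      forall A : set (Borel E), measurable A ->
        (exists n : nat, mu A = n%:R%:E) \/ mu A = +oo%E
    & forall K : set E, compact K -> (mu K < +oo)%E].

(** An infinite mass is sent to the default value 0; on Borel subsets of a compact set the mass is a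
    natural number and is recovered exactly. On singletons this is convertible to [atom_mult]. *)
Definition mult {R : realType} {E : completePseudoMetricType R}
    (mu : cfg E) (A : set E) : nat := Num.truncn (fine (mu A)).

Section CountingMeasure.
Context {R : realType} {E : completePseudoMetricType R}.
Hypothesis E_hausdorff : hausdorff_space E.
Hypothesis E_second_countable : @second_countable E.

Lemma compact_borel (K : set E) : compact K -> measurable (K : set (Borel E)).
Proof. by move=> cK; apply: closed_borel; exact: compact_closed. Qed.

Lemma counting_subset (mu : cfg E) (K : set E) (A : set (Borel E)) :
  counting mu -> compact K -> measurable A -> A `<=` K ->
  mu A = (mult mu A)%:R%:E.
Proof.
move=> [mu_meas mu_int mu_fin] cK mA AK; have [m mE] := is_measure_fun_measure mu_meas.
have mK := compact_borel cK.
have : (mu A < +oo)%E.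
  rewrite -mE//; apply: (@le_lt_trans _ _ (m K)); first by apply: le_measure; rewrite ?inE.
  by rewrite mE//; exact: mu_fin.
by case: (mu_int A mA) => [[n muA]|->//] _; rewrite /mult muA /= natrK.
Qed.

(** One list of atoms serves all [B] at once: it exhausts the mass of [K], so [B] minus the list is
    a null set by monotonicity. *)
Lemma mult_atoms (mu : cfg E) (K : set E) : counting mu -> compact K ->
  exists2 s : seq E, uniq s & forall B : set (Borel E), measurable B ->
    B `<=` K -> mult mu B = (\sum_(x <- s | x \in B) atom_mult mu x)%N.
Proof.
move=> mu_cnt cK; have [mu_meas _ mu_fin] := mu_cnt.
have mK := compact_borel cK.
have [m mE] := is_measure_fun_measure mu_meas.
have mKE : m K = (mult mu K)%:R%:E by rewrite mE//; exact: counting_subset cK _ _.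
have m_int (B : set (Borel E)) : measurable B -> B `<=` K -> exists n : nat, m B = n%:R%:E.
  move=> mB BK; exists (mult mu B); rewrite mE//; exact: counting_subset cK _ _.
have mK_fin : (m K < +oo)%E by rewrite mKE ltry.
have [s [us sK ms]] := exists_atoms E_hausdorff E_second_countable mK mK_fin m_int mK
  (@subset_refl _ _) mKE.
exists s => // B mB BK; set t := [seq x <- s | x \in B].
have tE : B `&` [set` s] = [set` t].
  apply/seteqP; split=> x /=; rewrite mem_filter.
    by move=> [Bx ->]; rewrite andbT inE.
  by move=> /andP[]; rewrite inE.
have mBs : m (B `\` [set` s]) = 0%E.
  apply/eqP; rewrite eq_le measure_ge0 andbT -ms; apply: le_measure; rewrite ?inE.
  - by apply: measurableD => //; exact: seq_borel.
  - by apply: measurableD => //; exact: seq_borel.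
  - by move=> x [Bx sx]; split=> //; exact: BK.
have mBt : m B = m [set` t].
  rewrite -tE (measureDI m mB (seq_borel E_hausdorff s)) -[RHS]add0e.
  by congr (_ + _)%E.
rewrite {1}/mult -mE// mBt (measure_seq E_hausdorff)//; last exact: filter_uniq.
rewrite big_filter [X in fine X](_ : _ = (\sum_(x <- s | x \in B) atom_mult mu x)%N%:R%:E);
  last rewrite natr_sum -sumEFin big_seq_cond [RHS]big_seq_cond.
  by rewrite /= natrK.
apply: eq_bigr => x /andP[xs]; rewrite inE => Bx.
rewrite mE; last exact: set1_borel.
by apply: (counting_subset mu_cnt cK); [exact: set1_borel|move=> _ ->; exact: BK].
Qed.

(** Off [s] every factor is 1: outside [K] the function [phi] vanishes, and at a point of [K]
    outside [s] the formula for multiplicities, applied to the singleton, gives exponent 0. *)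
Lemma pgfl_integrand_seq (mu : cfg E) (K : set E) (s : seq E) (phi : E -> R[i]) :
  uniq s ->
  (forall B : set (Borel E), measurable B -> B `<=` K ->
    mult mu B = (\sum_(x <- s | x \in B) atom_mult mu x)%N) ->
  (forall x, phi x != 0 -> K x) ->
  pgfl_integrand mu phi = \prod_(x <- s) (1 + phi x) ^+ atom_mult mu x.
Proof.
move=> us sP phiK; rewrite /pgfl_integrand (fsbigE s)//.
  by apply: eq_bigl => x; rewrite in_setT.
move=> x _ xs; have [->|/phiK Kx] := eqVneq (phi x) 0; first by rewrite addr0 expr1n.
rewrite (_ : atom_mult mu x = 0%N) ?expr0//.
rewrite -[LHS]/(mult mu [set x]) sP; [|exact: set1_borel|by move=> _ ->].
rewrite big_seq_cond big1// => y /andP[ys]; rewrite inE /= => yx.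
by rewrite yx (negPf xs) in ys.
Qed.

End CountingMeasure.

Section Fibers.
Context {R : realType} {T : choiceType} {C : comPzRingType}.

(** The factors are grouped by the value of [f]. The only value that [V] may miss is 0, and there
    [c 0 = 0] makes the factor 1. *)
Lemma prod_fibers (V : seq R) (f : T -> R) (c : R -> C) (s : seq T)
    (k : T -> nat) : uniq V -> (forall x, f x \in V \/ f x = 0) -> c 0 = 0 ->
  \prod_(x <- s) (1 + c (f x)) ^+ k x =
  \prod_(v <- V) (1 + c v) ^+ (\sum_(x <- s | x \in f @^-1` [set v]) k x)%N.
Proof.
move=> uV fV c0; under [RHS]eq_bigr do rewrite expr_sum.
rewrite (exchange_big_dep xpredT)//=; apply: eq_bigr => x _.
have xfE v : (x \in f @^-1` [set v]) = (f x == v).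
  by apply/idP/eqP; rewrite inE.
under eq_bigl do rewrite xfE.
have [xV|xV] := boolP (f x \in V).
  rewrite big_mkcond (bigD1_seq (f x))//= eqxx big1 ?mulr1// => v.
  by rewrite eq_sym => /negPf ->.
rewrite big_seq_cond big1 => [|v /andP[vV /eqP fxv]]; last first.
  by rewrite fxv vV in xV.
by case: (fV x) => [|->]; [rewrite (negPf xV)|rewrite c0 addr0 expr1n].
Qed.

Lemma prod_indicators (l : seq (set T * C)) (s : seq T) (k : T -> nat) :
  \prod_(x <- s) (\prod_(p <- l) p.2 ^+ (x \in p.1)) ^+ k x =
  \prod_(p <- l) p.2 ^+ (\sum_(x <- s | x \in p.1) k x)%N.
Proof.
under [LHS]eq_bigr do rewrite -prodrXl.
rewrite exchange_big /=; apply: eq_bigr => p _.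
rewrite expr_sum [RHS]big_mkcond; apply: eq_bigr => x _.
by case: (x \in p.1); rewrite ?expr1// expr0 expr1n.
Qed.

End Fibers.

(** * Test functions of finite range *)

Definition tilt {R : realType} {E : choiceType} (l : seq (set E * R)) (x : E) : R :=
  \prod_(p <- l) p.2 ^+ (x \in p.1) - 1.

(** Replaces the product over the points of [E] by a product over finitely many values, which is
    visibly measurable in [mu]. The map [c] is kept general so as to cover both the dilations by [z]
    and the dominating function used for continuity. *)
Definition fiber_prod {R : realType} {E : completePseudoMetricType R}
    (V : seq R) (f : E -> R) (c : R -> R[i]) (mu : cfg E) : R[i] :=
  \prod_(v <- V) (1 + c v) ^+ mult mu (f @^-1` [set v]).

(** Each further set at most doubles the list of values of the product, as its weight is either
    applied or not. The value 1 of the product, which becomes 0 after the shift, is discarded. *)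
Lemma tilt_range {R : realType} {E : choiceType} (l : seq (set E * R)) :
  exists V : seq R, [/\ uniq V, 0 \notin V &
    forall x, tilt l x \in V \/ tilt l x = 0].
Proof.
have [W WP] : exists W : seq R, forall x : E,
    \prod_(p <- l) p.2 ^+ (x \in p.1) \in W.
  elim: l => [|p l [W WP]].
    by exists [:: 1] => x; rewrite big_nil inE.
  exists (W ++ [seq p.2 * w | w <- W]) => x.
  rewrite big_cons mem_cat; case: (x \in p.1).
    by rewrite expr1 map_f ?orbT.
  by rewrite expr0 mul1r WP.
exists (undup [seq w - 1 | w <- W & w != 1]).
rewrite undup_uniq mem_undup; split=> //.
  apply/negP => /mapP[w]; rewrite mem_filter => /andP[w1 _] /esym/eqP.
  by rewrite subr_eq0 (negPf w1).
move=> x; have := WP x; rewrite /tilt; set w := \prod_(_ <- _) _ => wW.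
have [->|w1] := eqVneq w 1; first by right; rewrite subrr.
by left; rewrite mem_undup; apply/mapP; exists w; rewrite ?mem_filter ?w1.
Qed.

Section FiniteRange.
Context {R : realType} {E : completePseudoMetricType R}.
Hypothesis E_hausdorff : hausdorff_space E.
Hypothesis E_second_countable : @second_countable E.
Variables (K : set E) (f : E -> R) (V : seq R).
Hypothesis cK : compact K.
Hypothesis mf : measurable_fun [set: Borel E] (f : Borel E -> R).
Hypothesis fK : forall x, f x != 0 -> K x.
Hypotheses (uV : uniq V) (V0 : 0 \notin V).
Hypothesis fV : forall x, f x \in V \/ f x = 0.

Lemma fiber_measurable v : measurable (f @^-1` [set v] : set (Borel E)).
Proof. by rewrite -[X in measurable X]setTI; exact: mf. Qed.

Lemma fiber_sub v : v \in V -> f @^-1` [set v] `<=` K.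
Proof.
by move=> vV x /= fxv; apply: fK; rewrite fxv; apply: contraNneq V0 => <-.
Qed.

(** No regularity of [g] is involved: a preimage under the composite is a finite union of fibers of
    [f]. *)
Lemma finite_range_measurable_comp (g : R -> R) :
  measurable_fun [set: Borel E] (fun x : Borel E => g (f x)).
Proof.
move=> _ Y mY; rewrite setTI.
have -> : (fun x => g (f x)) @^-1` Y =
    \big[setU/set0]_(v <- 0 :: V | g v \in Y) (f @^-1` [set v]).
  apply/seteqP; split=> x /=; rewrite -bigcup_seq_cond.
    move=> Yx; exists (f x) => //=; rewrite (mem_set Yx) andbT inE.
    by case: (fV x) => ->; rewrite ?eqxx ?orbT.
  by move=> [v /= /andP[_]]; rewrite inE => Yv /= ->.
by apply: bigsetU_measurable => v _; exact: fiber_measurable.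
Qed.

Lemma finite_range_Bc (c : R -> R[i]) : c 0 = 0 -> Bc (fun x => c (f x)).
Proof.
move=> c0; split.
- exists (\sum_(v <- 0 :: V) Normc.normc (c v)) => x.
  have -> : `|c (f x)| = (Normc.normc (c (f x)))%:C%C by [].
  rewrite lecR; have fx : f x \in 0 :: V.
    by rewrite inE; case: (fV x) => ->; rewrite ?eqxx ?orbT.
  rewrite (big_rem _ fx) /= lerDl; apply: sumr_ge0 => v _.
  by case: (c v) => a b; exact: sqrtr_ge0.
- exact: (finite_range_measurable_comp (fun v => complex.Re (c v))).
- exact: (finite_range_measurable_comp (fun v => complex.Im (c v))).
- apply: (subclosed_compact _ cK); first exact: closed_closure.
  have KE : K = closure K by apply/closure_id; exact: compact_closed.
  rewrite [X in _ `<=` X]KE; apply: closureS => x /=; apply: contra_neqP => /= Kx.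
  by have [->//|/fK] := eqVneq (f x) 0.
Qed.

Lemma pgfl_integrand_fibers (c : R -> R[i]) (mu : cfg E) : c 0 = 0 -> counting mu ->
  pgfl_integrand mu (fun x => c (f x)) = fiber_prod V f c mu.
Proof.
move=> c0 mu_cnt; have [s us sP] := mult_atoms E_hausdorff E_second_countable mu_cnt cK.
rewrite (pgfl_integrand_seq E_hausdorff us sP); last first.
  by move=> x; have [->|/fK//] := eqVneq (f x) 0; rewrite c0 eqxx.
rewrite (prod_fibers _ _ uV fV c0); apply: eq_big_seq => v vV.
by rewrite -sP//; [exact: fiber_measurable|exact: fiber_sub].
Qed.

End FiniteRange.

Section Tilt.
Context {R : realType} {E : completePseudoMetricType R}.
Hypothesis E_hausdorff : hausdorff_space E.
Hypothesis E_second_countable : @second_countable E.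
Variables (K : set E) (l : seq (set E * R)).
Hypothesis cK : compact K.
Hypothesis lK : forall p, p \in l -> measurable (p.1 : set (Borel E)) /\ p.1 `<=` K.

Lemma tilt_measurable : measurable_fun [set: Borel E] (tilt l : Borel E -> R).
Proof.
apply: measurable_funB; last exact: measurable_cst.
apply: measurable_prod => p pl; have [mp _] := lK pl.
have -> : (fun x : Borel E => p.2 ^+ (x \in p.1)) =
    (fun x : Borel E => if x \in p.1 then p.2 else 1).
  by apply/funext => x; case: (x \in p.1).
apply: measurable_fun_ifT; [|exact: measurable_cst|exact: measurable_cst].
apply: (measurable_fun_bool true); rewrite setTI.
suff -> : (fun x : E => x \in p.1) @^-1` [set true] = p.1 by [].
by apply/seteqP; split=> x /=; rewrite -[_ = true]/(is_true _) inE.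
Qed.

Lemma tilt_supp x : tilt l x != 0 -> K x.
Proof.
apply: contra_neqP => Kx; rewrite /tilt big_seq big1 ?subrr// => p pl.
have [_ pK] := lK pl; rewrite memNset ?expr0//.
by move=> /pK.
Qed.

(** Here [1 + tilt l x] is the product of the weights of the sets containing x; exchanging the
    products over atoms and over sets collects, for each set, its total multiplicity as exponent. *)
Lemma pgfl_integrand_tilt (mu : cfg E) : counting mu ->
  pgfl_integrand mu (fun x => (tilt l x)%:C%C) =
  (\prod_(p <- l) p.2 ^+ mult mu p.1)%:C%C.
Proof.
move=> mu_cnt; have [s us sP] := mult_atoms E_hausdorff E_second_countable mu_cnt cK.
rewrite (pgfl_integrand_seq E_hausdorff us sP); last first.
  by move=> x; have [->|/tilt_supp//] := eqVneq (tilt l x) 0; rewrite eqxx.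
under eq_bigr => x _.
  rewrite -[1]/(1%:C%C) -rmorphD /= addrC subrK -rmorphXn /=.
  over.
rewrite -rmorph_prod /= (prod_indicators l s (atom_mult mu)); congr (_ +i* 0)%C.
by apply: eq_big_seq => p pl; have [mp pK] := lK pl; rewrite sP.
Qed.

End Tilt.

(** * Integrals, laws and independence *)

Lemma mfun_of_measurable d d' (X : measurableType d) (Y1 : measurableType d')
    (f : X -> Y1) :
  measurable_fun [set: X] f -> exists F : {mfun X >-> Y1}, (F : X -> Y1) = f.
Proof.
by move=> mf; exists (MeasurableFun.Pack (MeasurableFun.Class
  (isMeasurableFun.Build _ _ _ _ _ mf))).
Qed.

Section Laws.
Context {R : realType} d1 d2 (Y1 : measurableType d1) (Y2 : measurableType d2).

(** Both expectations are integrals of [f] against the same image measure; finiteness of the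
    integral of its modulus passes from one space to the other in the same way. *)
Lemma eq_law_integrable d d' (X : measurableType d) (X' : measurableType d')
    (P : probability X R) (P' : probability X' R) (phi : X -> Y1) (phi' : X' -> Y1)
    (f : Y1 -> R) :
  measurable_fun [set: X] phi -> measurable_fun [set: X'] phi' ->
  (forall S, measurable S -> P (phi @^-1` S) = P' (phi' @^-1` S)) ->
  measurable_fun [set: Y1] f ->
  P.-integrable [set: X] (fun x => (f (phi x))%:E) ->
  P'.-integrable [set: X'] (fun x => (f (phi' x))%:E) /\
  Rintegral P [set: X] (fun x => f (phi x)) =
  Rintegral P' [set: X'] (fun x => f (phi' x)).
Proof.
move=> /mfun_of_measurable[F <-] /mfun_of_measurable[F' <-] PP' mf intf.
have mFf : measurable_fun [set: Y1] (EFin \o f) by exact/measurable_EFinP.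
have intF : (distribution P F).-integrable [set: Y1] (EFin \o f).
  by apply: integrable_pushforward.
have DE (S : set Y1) : measurable S -> S `<=` [set: Y1] ->
    distribution P F S = distribution P' F' S.
  by move=> mS _; exact: PP'.
have intF' : P'.-integrable [set: X'] (fun x => (f (F' x))%:E).
  case/integrableP: intF => _ ltF; apply/integrableP; split.
    by apply/measurable_EFinP; apply: measurableT_comp.
  rewrite (eq_measure_integral (distribution P' F') DE) in ltF.
  apply: le_lt_trans ltF; rewrite (@ge0_integral_pushforward _ _ _ _ _ F')//.
  exact: measurableT_comp.
split=> //; rewrite /Rintegral; congr fine.
rewrite -[LHS](@integral_pushforward _ _ _ _ _ F _ P setT (EFin \o f))//.
rewrite -[RHS](@integral_pushforward _ _ _ _ _ F' _ P' setT (EFin \o f))//.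
exact: eq_measure_integral DE.
Qed.

(** Independence says that the law of the pair agrees with the product of the laws on rectangles,
    hence everywhere. Tonelli then gives integrability of the product, and Fubini its value. *)
Lemma indep_integrable d (X : measurableType d) (P : probability X R)
    (phi1 : X -> Y1) (phi2 : X -> Y2) (f1 : Y1 -> R) (f2 : Y2 -> R) :
  measurable_fun [set: X] phi1 -> measurable_fun [set: X] phi2 ->
  (forall S1 S2, measurable S1 -> measurable S2 ->
    P (phi1 @^-1` S1 `&` phi2 @^-1` S2) =
    (P (phi1 @^-1` S1) * P (phi2 @^-1` S2))%E) ->
  measurable_fun [set: Y1] f1 -> measurable_fun [set: Y2] f2 ->
  P.-integrable [set: X] (fun x => (f1 (phi1 x))%:E) ->
  P.-integrable [set: X] (fun x => (f2 (phi2 x))%:E) ->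
  P.-integrable [set: X] (fun x => (f1 (phi1 x) * f2 (phi2 x))%:E) /\
  Rintegral P [set: X] (fun x => f1 (phi1 x) * f2 (phi2 x)) =
  Rintegral P [set: X] (fun x => f1 (phi1 x)) *
  Rintegral P [set: X] (fun x => f2 (phi2 x)).
Proof.
move=> /mfun_of_measurable[F1 <-] /mfun_of_measurable[F2 <-] ind mf1 mf2 if1 if2.
pose m1 := distribution P F1; pose m2 := distribution P F2.
have [F FE] : exists F : {mfun X >-> (Y1 * Y2)%type},
    (F : X -> (Y1 * Y2)%type) = (fun x => (F1 x, F2 x)).
  by apply: mfun_of_measurable; exact: measurable_fun_pair.
have prodE (S : set (Y1 * Y2)) : measurable S -> S `<=` [set: _] ->
    (m1 \x m2)%E S = distribution P F S.
  move=> mS _; apply: product_measure_unique mS => A B mA mB.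
  transitivity (P (F @^-1` (A `*` B))); first by [].
  by rewrite FE -[RHS]ind.
pose g (y : Y1 * Y2) : R := f1 y.1 * f2 y.2.
have mg : measurable_fun [set: Y1 * Y2] g.
  by apply: measurable_funM; apply: measurableT_comp.
have im1 : m1.-integrable [set: Y1] (EFin \o f1).
  by apply: integrable_pushforward => //; exact/measurable_EFinP.
have im2 : m2.-integrable [set: Y2] (EFin \o f2).
  by apply: integrable_pushforward => //; exact/measurable_EFinP.
have ig : (m1 \x m2)%E.-integrable [set: Y1 * Y2] (EFin \o g).
  apply/integrable12ltyP; first exact/measurable_EFinP.
  have -> : (\int[m1]_x \int[m2]_y `|(EFin \o g) (x, y)| =
      \int[m1]_x (`|(EFin \o f1) x| * \int[m2]_y `|(EFin \o f2) y|))%E.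
    apply: eq_integral => x _; rewrite -ge0_integralZl//.
      by apply: eq_integral => y _; rewrite /= normrM EFinM.
    by apply: measurableT_comp => //; exact/measurable_EFinP.
  have /integrableP[_ n1] := im1; have /integrableP[_ n2] := im2.
  rewrite ge0_integralZr//.
  - apply: lte_mul_pinfty => //; first exact: integral_ge0.
    by rewrite ge0_fin_numE//; exact: integral_ge0.
  - by apply: measurableT_comp => //; exact/measurable_EFinP.
  - exact: integral_ge0.
have intg : P.-integrable [set: X] (fun x => (f1 (F1 x) * f2 (F2 x))%:E).
  case/integrableP: ig => _ ltg; apply/integrableP; split.
    by apply/measurable_EFinP; apply: measurable_funM; apply: measurableT_comp.
  rewrite (eq_measure_integral (distribution P F) prodE) in ltg.
  apply: le_lt_trans ltg.
  rewrite (@ge0_integral_pushforward _ _ _ _ _ F)//; last first.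
    by apply: measurableT_comp => //; exact/measurable_EFinP.
  rewrite preimage_setT le_eqVlt; apply/orP; left; apply/eqP.
  by apply: eq_integral => x _ /=; rewrite FE.
split=> //.
have FP : (\int[P]_x (f1 (F1 x) * f2 (F2 x))%:E = \int[m1 \x m2]_z (g z)%:E)%E.
  rewrite (eq_measure_integral (distribution P F) prodE).
  rewrite (@integral_pushforward _ _ _ _ _ F _ P setT (EFin \o g))//.
  - by apply: eq_integral => x _ /=; rewrite FE.
  - exact/measurable_EFinP.
  - by rewrite FE.
rewrite /Rintegral FP -integral12_prod_meas1//= /fubini_F /=.
have E1 : (\int[P]_x (f1 (F1 x))%:E = \int[m1]_x (f1 x)%:E)%E.
  by rewrite (@integral_pushforward _ _ _ _ _ F1 _ P setT (EFin \o f1))//;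
    exact/measurable_EFinP.
have E2 : (\int[P]_x (f2 (F2 x))%:E = \int[m2]_x (f2 x)%:E)%E.
  by rewrite (@integral_pushforward _ _ _ _ _ F2 _ P setT (EFin \o f2))//;
    exact/measurable_EFinP.
rewrite E1 E2.
have i2fin : (\int[m2]_y (f2 y)%:E)%E \is a fin_num by exact: integrable_fin_num.
have -> : (\int[m1]_x \int[m2]_y (g (x, y))%:E =
    \int[m1]_x ((f1 x)%:E * (fine (\int[m2]_y (f2 y)%:E))%:E))%E.
  apply: eq_integral => x _; rewrite fineK// -integralZl//.
by rewrite integralZr// fineK// fineM//; exact: integrable_fin_num.
Qed.

End Laws.

(** * Complex-valued integrals *)

Section ComplexIntegral.
Context {R : realType}.

Definition cmeasurable d (X : measurableType d) (f : X -> R[i]) : Prop :=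
  measurable_fun [set: X] (fun x => complex.Re (f x)) /\
  measurable_fun [set: X] (fun x => complex.Im (f x)).

Definition cintegrable d (X : measurableType d) (P : probability X R)
    (f : X -> R[i]) : Prop :=
  P.-integrable [set: X] (fun x => (complex.Re (f x))%:E) /\
  P.-integrable [set: X] (fun x => (complex.Im (f x))%:E).

(** Written by components so that [pgfl P L phi] is convertible to the [cintegral] of
    [pgfl_integrand (L w) phi]. *)
Definition cintegral d (X : measurableType d) (P : probability X R)
    (f : X -> R[i]) : R[i] :=
  Complex (Rintegral P [set: X] (fun x => complex.Re (f x)))
          (Rintegral P [set: X] (fun x => complex.Im (f x))).

Lemma ReM (a b : R[i]) :
  complex.Re (a * b) = complex.Re a * complex.Re b - complex.Im a * complex.Im b.
Proof. by case: a b => [? ?] [? ?]. Qed.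

Lemma ImM (a b : R[i]) :
  complex.Im (a * b) = complex.Re a * complex.Im b + complex.Im a * complex.Re b.
Proof. by case: a b => [? ?] [? ?]. Qed.

Lemma cmeasurableM d (X : measurableType d) (f g : X -> R[i]) :
  cmeasurable f -> cmeasurable g -> cmeasurable (fun x => f x * g x).
Proof.
move=> [mfr mfi] [mgr mgi]; split.
  under eq_fun do rewrite ReM.
  by apply: measurable_funB; apply: measurable_funM.
under eq_fun do rewrite ImM.
by apply: measurable_funD; apply: measurable_funM.
Qed.

Lemma cmeasurable_prod d (X : measurableType d) (I : Type) (s : seq I)
    (f : I -> X -> R[i]) :
  (forall i, cmeasurable (f i)) -> cmeasurable (fun x => \prod_(i <- s) f i x).
Proof.
move=> mf; elim: s => [|i s IHs].
  by under eq_fun do rewrite big_nil; split; exact: measurable_cst.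
by under eq_fun do rewrite big_cons; exact: cmeasurableM.
Qed.

Lemma eq_law_cintegral d1 (Y : measurableType d1) d d' (X : measurableType d)
    (X' : measurableType d') (P : probability X R) (P' : probability X' R)
    (phi : X -> Y) (phi' : X' -> Y) (f : Y -> R[i]) :
  measurable_fun [set: X] phi -> measurable_fun [set: X'] phi' ->
  (forall S, measurable S -> P (phi @^-1` S) = P' (phi' @^-1` S)) ->
  cmeasurable f -> cintegrable P (fun x => f (phi x)) ->
  cintegral P (fun x => f (phi x)) = cintegral P' (fun x => f (phi' x)).
Proof.
move=> mphi mphi' PP' [mfr mfi] [ifr ifi]; rewrite /cintegral.
by rewrite (eq_law_integrable mphi mphi' PP' mfr ifr).2
  (eq_law_integrable mphi mphi' PP' mfi ifi).2.
Qed.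

Lemma indep_cintegral d1 d2 (Y1 : measurableType d1) (Y2 : measurableType d2)
    d (X : measurableType d) (P : probability X R)
    (phi1 : X -> Y1) (phi2 : X -> Y2) (f1 : Y1 -> R[i]) (f2 : Y2 -> R[i]) :
  measurable_fun [set: X] phi1 -> measurable_fun [set: X] phi2 ->
  (forall S1 S2, measurable S1 -> measurable S2 ->
    P (phi1 @^-1` S1 `&` phi2 @^-1` S2) =
    (P (phi1 @^-1` S1) * P (phi2 @^-1` S2))%E) ->
  cmeasurable f1 -> cmeasurable f2 ->
  cintegrable P (fun x => f1 (phi1 x)) -> cintegrable P (fun x => f2 (phi2 x)) ->
  cintegrable P (fun x => f1 (phi1 x) * f2 (phi2 x)) /\
  cintegral P (fun x => f1 (phi1 x) * f2 (phi2 x)) =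
  cintegral P (fun x => f1 (phi1 x)) * cintegral P (fun x => f2 (phi2 x)).
Proof.
move=> m1 m2 ind [mf1r mf1i] [mf2r mf2i] [if1r if1i] [if2r if2i].
have [irr Err] := indep_integrable m1 m2 ind mf1r mf2r if1r if2r.
have [iri Eri] := indep_integrable m1 m2 ind mf1r mf2i if1r if2i.
have [iir Eir] := indep_integrable m1 m2 ind mf1i mf2r if1i if2r.
have [iii Eii] := indep_integrable m1 m2 ind mf1i mf2i if1i if2i.
split.
  split.
    by under eq_fun do rewrite ReM EFinB; exact: integrableB.
  by under eq_fun do rewrite ImM EFinD; exact: integrableD.
rewrite /cintegral; under eq_Rintegral do rewrite ReM.
under [X in (_ +i* X)%C]eq_Rintegral do rewrite ImM.
by rewrite RintegralB// RintegralD// Err Eri Eir Eii.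
Qed.

End ComplexIntegral.

(** * The measurable space of configurations *)

Section Configurations.
Context {R : realType} {E : completePseudoMetricType R}.

Definition cfg_space : Type := g_sigma_algebraType (@cfg_gen R E).

Lemma eval_measurable (A : set (Borel E)) : measurable A ->
  measurable_fun [set: cfg_space] (fun mu : cfg_space => mu A).
Proof.
move=> mA _ U mU; rewrite setTI; apply: sub_sigma_algebra.
by exists A, U.
Qed.

Lemma truncn_measurable :
  measurable_fun [set: R] (fun x : R => Num.truncn x : nat).
Proof.
have mge n : measurable [set x : R | (n <= Num.truncn x)%N].
  (* The level 0 is separate: negative reals also truncate to 0, so its set is the whole line and
     not a half-line starting at 0. *)
  case: n => [|n]; first by rewrite (_ : [set _ | _] = setT)//; apply/seteqP.
  rewrite (_ : [set _ | _] = `[n.+1%:R, +oo[%classic); first exact: measurable_itv.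
  by apply/seteqP; split=> x /=; rewrite in_itv /= andbT truncn_gt_nat.
move=> _ Y _; rewrite setTI.
have -> : (fun x : R => Num.truncn x : nat) @^-1` Y = \bigcup_(n in Y)
    ([set x : R | (n <= Num.truncn x)%N] `\` [set x : R | (n.+1 <= Num.truncn x)%N]).
  apply/seteqP; split=> x /=.
    by move=> Yx; exists (Num.truncn x) => //; split=> //=; rewrite ltnn.
  move=> [n Yn /= [nx /negP]]; rewrite -leqNgt => xn.
  by rewrite (_ : Num.truncn x = n)//; apply/eqP; rewrite eqn_leq xn nx.
by apply: bigcup_measurable => n _; apply: measurableD; exact: mge.
Qed.

Lemma mult_measurable (A : set (Borel E)) : measurable A ->
  measurable_fun [set: cfg_space] (fun mu : cfg_space => mult mu A).
Proof.
move=> mA; apply: (measurableT_comp truncn_measurable).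
by apply: measurableT_comp; [exact: fine_measurable|exact: eval_measurable].
Qed.

Lemma fiber_prod_measurable (V : seq R) (f : E -> R) (c : R -> R[i]) :
  measurable_fun [set: Borel E] (f : Borel E -> R) ->
  cmeasurable (fiber_prod V f c : cfg_space -> R[i]).
Proof.
move=> mf; apply: cmeasurable_prod => v.
have mm : measurable_fun [set: cfg_space]
    (fun mu : cfg_space => mult mu (f @^-1` [set v])).
  by apply: mult_measurable; exact: fiber_measurable.
by split; [apply: (measurableT_comp (f := fun n : nat => complex.Re ((1 + c v) ^+ n)))|
  apply: (measurableT_comp (f := fun n : nat => complex.Im ((1 + c v) ^+ n)))].
Qed.

Lemma measurable_into_cfg d (Omega : measurableType d) (L : Omega -> cfg E) :
  (forall A : set (Borel E), measurable A ->
    measurable_fun [set: Omega] (fun w => L w A)) ->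
  measurable_fun [set: Omega] (L : Omega -> cfg_space).
Proof.
move=> mL; apply: (@measurability _ _ Omega cfg_space setT L (@cfg_gen R E)) => //.
move=> _ [_ [A [U [mA mU ->]]] <-]; exact: (mL A mA).
Qed.

Lemma point_process_measurable d (Omega : measurableType d) (L : Omega -> cfg E) :
  point_process L -> measurable_fun [set: Omega] (L : Omega -> cfg_space).
Proof. by case=> _ _ _; exact: measurable_into_cfg. Qed.

Lemma point_process_counting d (Omega : measurableType d) (L : Omega -> cfg E) w :
  point_process L -> counting (L w).
Proof. by case=> L1 L2 L3 _; split; [exact: L1|exact: L2|exact: L3]. Qed.

Lemma pp_add_measurable d (Omega : measurableType d) (L1 L2 : Omega -> cfg E) :
  point_process L1 -> point_process L2 ->
  measurable_fun [set: Omega] (pp_add L1 L2 : Omega -> cfg_space).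
Proof.
move=> [_ _ _ mL1] [_ _ _ mL2]; apply: measurable_into_cfg => A mA.
by apply: emeasurable_funD; [exact: mL1|exact: mL2].
Qed.

End Configurations.

(** * Continuity and transfer of zeros *)

Section LocalQuotient.
Context {C : numFieldType}.

Definition continuous_at (g : C -> C) (z0 : C) : Prop :=
  forall e, 0 < e -> exists2 del, 0 < del &
    forall z, `|z - z0| < del -> `|g z - g z0| < e.

Lemma continuous_atP (g : C -> C) z0 :
  continuous_at g z0 <-> g z @[z --> z0] --> g z0.
Proof.
split=> [gc|gc].
  apply/(@cvgrPdist_lt _ _ _ (nbhs z0)) => e /gc[del del0 gdel].
  apply/nbhs_ballP; exists del => //= z; rewrite /ball /= => zdel.
  by rewrite distrC gdel// distrC.
move=> e e0; have nearz : nbhs z0 [set z | `|g z0 - g z| < e].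
  exact: (@cvgrPdist_lt _ _ _ (nbhs z0) _ _ _).1 gc e e0.
have [del /= del0 gdel] := (nbhs_ballP z0 _).1 nearz.
exists del => // z zdel.
by rewrite distrC; apply: gdel; rewrite /ball /= distrC.
Qed.

Lemma continuous_at_mul_div (g f1 f2 : C -> C) z0 : continuous_at g z0 ->
  continuous_at f1 z0 -> continuous_at f2 z0 -> f2 z0 != 0 ->
  continuous_at (fun z => g z * (f1 z / f2 z)) z0.
Proof.
move=> /continuous_atP gc /continuous_atP f1c /continuous_atP f2c.
move=> f20; apply/continuous_atP.
exact: (cvgM gc (cvgM f1c (cvgV f20 f2c))).
Qed.

End LocalQuotient.

(** In the partial order of the complex numbers a positive element is a positive real, so complex
    and real tolerances amount to the same. This links [continuous_at] with the form used in
    [zero_of_order]. *)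
Lemma continuous_at_complex {R : realType} (g : R[i] -> R[i]) z0 :
  continuous_at g z0 <-> forall e : R, 0 < e -> exists2 del : R, 0 < del &
    forall z, `|z - z0| < del%:C%C -> `|g z - g z0| < e%:C%C.
Proof.
have pos (e : R[i]) : 0 < e -> e = (complex.Re e)%:C%C /\ 0 < complex.Re e.
  by case: e => a b; rewrite ltcE /= => /andP[/eqP -> ->].
split=> gc e e0.
  have [|del /pos[-> del0] gdel] := gc e%:C%C; first by rewrite ltcR.
  by exists (complex.Re del).
have [-> e0'] := pos e e0; have [del del0 gdel] := gc _ e0'.
by exists del%:C%C; rewrite ?ltcR.
Qed.

(** From h2 = h1 f1 / f2 the new cofactor is g f1 / f2, again continuous and nonzero at [z0]. As
    [zero_of_order] asks for a continuous cofactor, continuity of [f1] and [f2] is enough. *)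
Lemma zero_of_order_quotient {R : realType} (f1 f2 h1 h2 : R[i] -> R[i]) z0 m :
  continuous_at f1 z0 -> continuous_at f2 z0 -> 
  (forall z, f1 z != 0) -> (forall z, f2 z != 0) ->
  (forall z, f1 z * h1 z = f2 z * h2 z) ->
  zero_of_order h1 z0 m -> zero_of_order h2 z0 m.
Proof.
move=> f1c f2c f10 f20 fh [g [gc g0 h1E]].
exists (fun z => g z * (f1 z / f2 z)); split.
- apply/continuous_at_complex; apply: continuous_at_mul_div => //.
  exact/continuous_at_complex.
- by rewrite mulf_neq0// mulf_neq0// invr_neq0.
- move=> z; apply: (mulfI (f20 z)); rewrite -fh h1E.
  by field; exact: f20.
Qed.

Section ProductLipschitz.
Context {C : numDomainType}.

(* [del * k * M] is the telescoping bound for the difference of two products of k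
   factors whose moduli multiply up to at most M; it is stable under products. *)
Definition near_factors (del : C) (t : C * C * C * nat) : Prop :=
  let: (a, b, M, k) := t in
  [/\ `|a| <= M, `|b| <= M & `|a - b| <= del * k%:R * M].

Lemma near_factorsM del a b M k a' b' M' k' :
  near_factors del (a, b, M, k) -> near_factors del (a', b', M', k') ->
  near_factors del (a * a', b * b', M * M', (k + k')%N).
Proof.
move=> [aM bM abM] [aM' bM' abM'].
have M0 : 0 <= M by exact: le_trans aM.
have M0' : 0 <= M' by exact: le_trans aM'.
split; rewrite ?normrM ?ler_pM//.
have -> : a * a' - b * b' = a * (a' - b') + (a - b) * b'.
  by rewrite mulrBr mulrBl addrA subrK.
apply: (le_trans (ler_normD _ _)); rewrite !normrM.
rewrite natrD mulrDr mulrDl addrC; apply: lerD.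
  by rewrite mulrA ler_pM.
by rewrite [leRHS]mulrCA ler_pM.
Qed.

Lemma near_factors1 del : near_factors del (1, 1, 1, 0%N).
Proof. by split; rewrite ?normr1// subrr normr0 mulr0 mul0r. Qed.

Lemma near_factorsX del a b M n : near_factors del (a, b, M, 1%N) ->
  near_factors del (a ^+ n, b ^+ n, M ^+ n, n).
Proof.
move=> ab; elim: n => [|n IHn]; first by rewrite !expr0; exact: near_factors1.
by rewrite !exprS -add1n; exact: near_factorsM.
Qed.

(** Telescoping costs the number of factors, which is at most 2 to that power. Spreading this power
    of 2 over the factors keeps the bound in the form of a product of powers, the kind of function
    that [class_C] makes integrable. *)
Lemma prod_lipschitz (I : Type) (s : seq I) (a b M : I -> C) (n : I -> nat)
    (del : C) : 0 <= del ->
  (forall i, near_factors del (a i, b i, M i, 1%N)) ->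
  `|\prod_(i <- s) a i ^+ n i - \prod_(i <- s) b i ^+ n i| <=
  del * \prod_(i <- s) (2 * M i) ^+ n i.
Proof.
move=> del0 abM.
have [] : near_factors del (\prod_(i <- s) a i ^+ n i, \prod_(i <- s) b i ^+ n i,
    \prod_(i <- s) M i ^+ n i, (\sum_(i <- s) n i)%N).
  elim: s => [|i s IHs]; first by rewrite !big_nil; exact: near_factors1.
  rewrite !big_cons; apply: near_factorsM => //; exact: near_factorsX.
move=> aM _ /le_trans; apply; rewrite -mulrA ler_wpM2l//.
under [leRHS]eq_bigr do rewrite exprMn.
rewrite big_split /= -expr_sum ler_wpM2r//; first exact: le_trans aM.
by rewrite -natrX ler_nat ltnW// ltn_expl.
Qed.

End ProductLipschitz.

Section ComplexNorm.
Context {R : realType}.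

Lemma normc_le_abs_add (a b : R) : `|(a +i* b)%C| <= (`|a| + `|b|)%:C%C.
Proof.
rewrite normc_def lecR /= -[leRHS]ger0_norm ?addr_ge0// -sqrtr_sqr.
apply: ler_wsqrtr; rewrite sqrrD !real_normK ?num_real// -addrA lerD2l lerDr.
by rewrite mulrn_wge0// mulr_ge0.
Qed.

Lemma normc_ge_Im (x : R[i]) : `|complex.Im x|%:C%C <= `|x|.
Proof.
by case: x => a b; rewrite normc_def lecR /= -sqrtr_sqr ler_wsqrtr// lerDr sqr_ge0.
Qed.

(** Real and imaginary parts are estimated separately, each by [del] times the integral of [D]; this
    is the origin of the factor 2. *)
Lemma cintegral_dist d (X : measurableType d) (P : probability X R)
    (f g : X -> R[i]) (D : X -> R) (del : R) : cintegrable P f -> cintegrable P g ->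
  P.-integrable [set: X] (EFin \o D) ->
  (forall x, `|f x - g x| <= (del * D x)%:C%C) ->
  `|cintegral P f - cintegral P g| <= (2 * (del * Rintegral P [set: X] D))%:C%C.
Proof.
move=> [frI fiI] [grI giI] DI fgD.
have DI' : P.-integrable [set: X] (EFin \o (fun x => del * D x)).
  by rewrite (_ : _ \o _ = (fun x => del%:E * (EFin \o D) x)%E)//; exact: integrableZl.
have bound (u v : X -> R) : P.-integrable [set: X] (EFin \o u) ->
    P.-integrable [set: X] (EFin \o v) -> (forall x, `|u x - v x| <= del * D x) ->
    `|Rintegral P [set: X] u - Rintegral P [set: X] v| <=
    del * Rintegral P [set: X] D.
  move=> uI vI uvD; rewrite -RintegralB// -RintegralZl//.
  have uvI : P.-integrable [set: X] (EFin \o (fun x => u x - v x)).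
    by rewrite (_ : _ \o _ = (fun x => (u x)%:E - (v x)%:E)%E)//; exact: integrableB.
  apply: (le_trans (le_normr_Rintegral _ uvI)) => //.
  by apply: le_Rintegral => //; exact: integrable_norm.
apply: (le_trans (normc_le_abs_add _ _)); rewrite lecR mulr_natl mulr2n; apply: lerD.
- apply: bound => // x; rewrite -lecR; apply: le_trans (fgD x).
  by have := normc_ge_Re (f x - g x); rewrite raddfB.
- apply: bound => // x; rewrite -lecR; apply: le_trans (fgD x).
  by have := normc_ge_Im (f x - g x); rewrite raddfB.
Qed.

End ComplexNorm.

(** * Generating functionals of finite-range test functions *)

Section Superposition.
Context {R : realType} {E : completePseudoMetricType R}.
Hypothesis E_hausdorff : hausdorff_space E.
Hypothesis E_second_countable : @second_countable E.
Variables (K : set E) (f : E -> R) (V : seq R).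
Hypothesis cK : compact K.
Hypothesis mf : measurable_fun [set: Borel E] (f : Borel E -> R).
Hypothesis fK : forall x, f x != 0 -> K x.
Hypotheses (uV : uniq V) (V0 : 0 \notin V).
Hypothesis fV : forall x, f x \in V \/ f x = 0.

(** Truncation is additive here because both masses are natural numbers, which is what the compact
    set [K] guarantees. *)
Lemma multD (mu1 mu2 : cfg E) (A : set (Borel E)) :
  counting mu1 -> counting mu2 -> measurable A -> A `<=` K ->
  mult (fun B => mu1 B + mu2 B)%E A = (mult mu1 A + mult mu2 A)%N.
Proof.
move=> mu1c mu2c mA AK; rewrite {1}/mult.
rewrite (counting_subset E_hausdorff mu1c cK mA AK).
rewrite (counting_subset E_hausdorff mu2c cK mA AK).
by rewrite -EFinD -natrD /= natrK.
Qed.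

Lemma fiber_prodD (c : R -> R[i]) (mu1 mu2 : cfg E) : counting mu1 -> counting mu2 ->
  fiber_prod V f c (fun B => mu1 B + mu2 B)%E =
  fiber_prod V f c mu1 * fiber_prod V f c mu2.
Proof.
move=> mu1c mu2c; rewrite /fiber_prod -big_split /=; apply: eq_big_seq => v vV.
by rewrite multD ?exprD//; [exact: fiber_measurable|exact: (fiber_sub fK V0 vV)].
Qed.

Lemma pgfl_fiber_prod d (Omega : measurableType d) (P : probability Omega R)
    (L : Omega -> cfg E) (c : R -> R[i]) : c 0 = 0 -> point_process L ->
  pgfl P L (fun x => c (f x)) = cintegral P (fun w => fiber_prod V f c (L w)).
Proof.
move=> c0 ppL; rewrite -[LHS]/(cintegral P (fun w => pgfl_integrand (L w) _)).
congr cintegral; apply/funext => w.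
apply: (pgfl_integrand_fibers E_hausdorff E_second_countable cK mf fK uV V0 fV c0).
exact: point_process_counting.
Qed.

Lemma fiber_prod_integrable d (Omega : measurableType d) (P : probability Omega R)
    (L : Omega -> cfg E) (c : R -> R[i]) : c 0 = 0 -> point_process L -> class_C P L ->
  cintegrable P (fun w => fiber_prod V f c (L w)).
Proof.
move=> c0 ppL CL.
have := CL _ (finite_range_Bc E_hausdorff cK mf fK fV c0).
suff -> : (fun w => fiber_prod V f c (L w)) =
  (fun w => pgfl_integrand (L w) (fun x => c (f x))) by [].
apply/funext => w; apply/esym.
apply: (pgfl_integrand_fibers E_hausdorff E_second_countable cK mf fK uV V0 fV c0).
exact: point_process_counting.
Qed.

(** Integrability for the sum is deduced from that of the two independent factors;
    [eq_law_cintegral] needs it to compare two superpositions. *)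
Lemma pgfl_add d (Omega : measurableType d) (P : probability Omega R)
    (L1 L2 : Omega -> cfg E) (c : R -> R[i]) : c 0 = 0 ->
  point_process L1 -> point_process L2 -> class_C P L1 -> class_C P L2 ->
  pp_indep P L1 L2 ->
  cintegrable P (fun w => fiber_prod V f c (pp_add L1 L2 w)) /\
  cintegral P (fun w => fiber_prod V f c (pp_add L1 L2 w)) =
  pgfl P L1 (fun x => c (f x)) * pgfl P L2 (fun x => c (f x)).
Proof.
move=> c0 pp1 pp2 C1 C2 ind; rewrite !pgfl_fiber_prod//.
have -> : (fun w => fiber_prod V f c (pp_add L1 L2 w)) =
    (fun w => fiber_prod V f c (L1 w) * fiber_prod V f c (L2 w)).
  by apply/funext => w; apply: fiber_prodD; exact: point_process_counting.
have mF := fiber_prod_measurable V c mf.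
apply: (indep_cintegral (point_process_measurable pp1) (point_process_measurable pp2)
  _ mF mF); try exact: fiber_prod_integrable.
by move=> S1 S2 mS1 mS2; exact: ind.
Qed.

(** On the disc of radius [r] the integrand is Lipschitz in z with a random constant [D], which is
    integrable; integrating the estimate gives continuity at [z0]. *)
Lemma pgfl_continuous d (Omega : measurableType d) (P : probability Omega R)
    (L : Omega -> cfg E) (z0 : R[i]) : point_process L -> class_C P L ->
  continuous_at (fun z => pgfl P L (fun x => z * (f x)%:C%C)) z0.
Proof.
move=> ppL CL.
pose c (z : R[i]) (v : R) := z * v%:C%C.
have c0 z : c z 0 = 0 by rewrite /c mulr0.
pose r : R := 1 + Normc.normc z0.
have r1 : 1 <= r by rewrite lerDl; case: (z0) => a b; exact: sqrtr_ge0.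
pose M (v : R) : R := 1 + r * `|v|.
have M1 v : 1 <= M v by rewrite lerDl mulr_ge0// (le_trans _ r1).
(* The dominating function is the integrand at [2 (1 + r |f|) - 1] on [f <> 0],
   which is integrable by [class_C]; the factor 2 absorbs the number of factors
   produced by telescoping. *)
pose dom (v : R) : R[i] := if v == 0 then 0 else (2 * M v)%:C%C - 1.
have dom0 : dom 0 = 0 by rewrite /dom eqxx.
pose D (w : Omega) : R :=
  \prod_(v <- V) (2 * M v) ^+ mult (L w) (f @^-1` [set v]).
have DE w : fiber_prod V f dom (L w) = (D w)%:C%C.
  rewrite rmorph_prod; apply: eq_big_seq => v vV.
  have /negPf v0 : v != 0 by apply: contraNneq V0 => <-.
  by rewrite /dom v0 addrC subrK rmorphXn.
have DI : P.-integrable [set: Omega] (EFin \o D).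
  have [+ _] := fiber_prod_integrable dom0 ppL CL.
  by under eq_fun do rewrite DE.
apply/continuous_at_complex => e e0.
set ID := Rintegral P [set: Omega] D.
have ID0 : 0 <= ID.
  apply: Rintegral_ge0 => w _; apply: prodr_ge0 => v _.
  by rewrite exprn_ge0// mulr_ge0// (le_trans _ (M1 v)).
(* The bound 1 keeps |z| below [r]. The other bound makes |z - z0| times 2 [ID] less than [e], the
   summand 1 keeping the denominator positive. *)
exists (Num.min 1 (e / (2 * ID + 1))).
  by rewrite lt_min ltr01 divr_gt0// ltr_wpDl// mulr_ge0.
move=> z; rewrite -[`|z - z0|]/((Normc.normc (z - z0))%:C%C) ltcR.
set del := Normc.normc (z - z0) => zdel.
have del0 : 0 <= del by rewrite /del; case: (z - z0) => a b; exact: sqrtr_ge0.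
have [z0r zr] : `|z0| <= r%:C%C /\ `|z| <= r%:C%C.
  have z0r : `|z0| <= r%:C%C.
    by rewrite -[`|z0|]/((Normc.normc z0)%:C%C) lecR lerDr.
  split=> //; rewrite -(subrK z0 z); apply: (le_trans (ler_normD _ _)).
  rewrite rmorphD /= -[`|z0|]/((Normc.normc z0)%:C%C) lerD2r.
  rewrite -[`|z - z0|]/(del%:C%C) lecR ltW// (lt_le_trans zdel)//.
  by rewrite ge_min lexx.
have factor_le u v : `|u| <= r%:C%C -> `|1 + u * v%:C%C| <= (M v)%:C%C.
  move=> ur; apply: (le_trans (ler_normD _ _)).
  rewrite normr1 /M rmorphD /= lerD2l normrM rmorphM /= ler_pM//.
  by rewrite normc_def /= expr0n /= addr0 sqrtr_sqr.
rewrite -[pgfl P L (fun x => z * _)]/(pgfl P L (fun x => c z (f x))).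
rewrite -[pgfl P L (fun x => z0 * _)]/(pgfl P L (fun x => c z0 (f x))).
rewrite !pgfl_fiber_prod//.
have lip w : `|fiber_prod V f (c z) (L w) - fiber_prod V f (c z0) (L w)| <=
    (del * D w)%:C%C.
  rewrite rmorphM /= rmorph_prod.
  under [X in _ <= _ * X]eq_bigr do rewrite rmorphXn rmorphM /= rmorph_nat.
  apply: prod_lipschitz; first by rewrite lecR.
  move=> v; split; [exact: factor_le|exact: factor_le|].
  rewrite (_ : 1 + c z v - (1 + c z0 v) = (z - z0) * v%:C%C); last by rewrite /c; ring.
  rewrite normrM -[`|z - z0|]/(del%:C%C) mulr1 ler_wpM2l//; first by rewrite lecR.
  rewrite normc_def /= expr0n /= addr0 sqrtr_sqr lecR.
  by rewrite /M (le_trans (ler_peMl _ r1))// lerDr.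
apply: le_lt_trans (cintegral_dist _ _ DI lip) _; try exact: fiber_prod_integrable.
rewrite ltcR -/ID mulrCA.
apply: (@le_lt_trans _ _ (del * (2 * ID + 1))).
  by rewrite ler_wpM2l// lerDl.
rewrite -ltr_pdivlMr ?ltr_wpDl ?mulr_ge0//.
by rewrite (lt_le_trans zdel)// ge_min lexx orbT.
Qed.

End Superposition.

(** If the integral were 0, [f] would vanish almost everywhere; since it vanishes nowhere, the whole
    space would be a null set. *)
Lemma Rintegral_gt0 {R : realType} d (X : measurableType d) (P : probability X R)
    (f : X -> R) : P.-integrable [set: X] (EFin \o f) -> (forall x, 0 < f x) ->
  0 < Rintegral P [set: X] f.
Proof.
move=> fI f0; rewrite lt_neqAle Rintegral_ge0 ?andbT; last by move=> x _; exact: ltW.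
apply/eqP => If0; have [mf _] := integrableP _ _ _ fI.
have : (\int[P]_x `|(EFin \o f) x| = 0)%E.
  under eq_integral => x _ do rewrite /= gtr0_norm//.
  by rewrite -[LHS]fineK ?(integrable_fin_num _ fI)// [fine _](esym If0).
move/(ae_eq_integral_abs P measurableT mf) => [N [mN PN0 subN]].
have NT : N = [set: X].
  apply/seteqP; split=> // x _; apply: subN => /= /(_ I) [] /eqP.
  by rewrite gt_eqF.
have := @probability_setT _ _ _ P; rewrite -NT => P1.
by move: PN0; rewrite [LHS]P1 => /eqP; rewrite onee_eq0.
Qed.

(** * Separating the two components of a superposition *)

Section TiltedProducts.
Context {R : realType} {E : completePseudoMetricType R}.
Hypothesis E_hausdorff : hausdorff_space E.
Hypothesis E_second_countable : @second_countable E.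

(** This is the joint probability generating function of the numbers of points in the sets [p.1],
    taken at the weights [p.2]. *)
Definition tilted_mean d (Omega : measurableType d) (P : probability Omega R)
    (L : Omega -> cfg E) (l : seq (set E * R)) : R :=
  Rintegral P [set: Omega] (fun w => \prod_(p <- l) p.2 ^+ mult (L w) p.1).

Definition compact_marks (l : seq (set E * R)) (K : set E) : Prop :=
  forall p, p \in l -> measurable (p.1 : set (Borel E)) /\ p.1 `<=` K.

Lemma pgfl_tilt d (Omega : measurableType d) (P : probability Omega R)
    (L : Omega -> cfg E) (K : set E) (l : seq (set E * R)) :
  compact K -> compact_marks l K -> point_process L ->
  pgfl P L (fun x => (tilt l x)%:C%C) = (tilted_mean P L l)%:C%C.
Proof.
move=> cK lK ppL; have intE w := pgfl_integrand_tilt E_hausdorff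
  E_second_countable cK lK (point_process_counting w ppL).
rewrite /pgfl; congr Complex; first by under eq_Rintegral do rewrite intE /=.
under eq_Rintegral do rewrite intE /=.
by rewrite Rintegral_cst// mul0r.
Qed.

Lemma tilted_mean_gt0 d (Omega : measurableType d) (P : probability Omega R)
    (L : Omega -> cfg E) (K : set E) (l : seq (set E * R)) :
  compact K -> compact_marks l K -> (forall p, p \in l -> 0 < p.2) ->
  point_process L -> class_C P L -> 0 < tilted_mean P L l.
Proof.
move=> cK lK l0 ppL CL; apply: Rintegral_gt0; last first.
  by move=> w; rewrite big_seq; apply: prodr_gt0 => p /l0; exact: exprn_gt0.
have [V [_ _ fV]] := tilt_range l.
have c0 : real_complex R 0 = 0 by [].
have [+ _] := CL _ (finite_range_Bc E_hausdorff cK (tilt_measurable lK)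
  (tilt_supp lK) fV c0).
suff -> : EFin \o (fun w => \prod_(p <- l) p.2 ^+ mult (L w) p.1) =
  (fun w => (complex.Re (pgfl_integrand (L w) (fun x => (tilt l x)%:C%C)))%:E) by [].
apply/funext => w; rewrite (pgfl_integrand_tilt E_hausdorff
  E_second_countable cK lK (point_process_counting w ppL)).
by [].
Qed.

Lemma superposition_tilted_mean d (Omega : measurableType d) (P : probability Omega R)
    (Theta Xi : Omega -> cfg E) d' (Omega' : measurableType d')
    (P' : probability Omega' R) (Theta' Xi' : Omega' -> cfg E)
    (K : set E) (l : seq (set E * R)) :
  point_process Theta -> point_process Xi -> pp_indep P Theta Xi ->
  point_process Theta' -> point_process Xi' -> pp_indep P' Theta' Xi' ->
  class_C_nonvanishing P Theta -> class_C_nonvanishing P' Theta' ->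
  class_C P Xi -> class_C P' Xi' ->
  zeros_determine P Xi P' Xi' ->
  eq_in_law P (pp_add Theta Xi) P' (pp_add Theta' Xi') ->
  compact K -> compact_marks l K -> (forall p, p \in l -> 0 < p.2) ->
  tilted_mean P Theta l = tilted_mean P' Theta' l /\
  tilted_mean P Xi l = tilted_mean P' Xi' l.
Proof.
move=> ppT ppX ind ppT' ppX' ind' [CT nT] [CT' nT'] CX CX' zd law cK lK l0.
have [V [uV V0 fV]] := tilt_range l.
have mf := tilt_measurable lK; have fK := tilt_supp lK.
pose phi (x : E) := (tilt l x)%:C%C.
have Bphi : Bc phi.
  exact: (finite_range_Bc (c := real_complex R) E_hausdorff cK mf fK fV).
have prodE z : pgfl P Theta (fun x => z * phi x) * pgfl P Xi (fun x => z * phi x) =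
    pgfl P' Theta' (fun x => z * phi x) * pgfl P' Xi' (fun x => z * phi x).
  pose c (v : R) : R[i] := z * v%:C%C.
  have c0 : c 0 = 0 by rewrite /c mulr0.
  have [I1 <-] := pgfl_add E_hausdorff E_second_countable cK mf fK uV V0 fV c0
    ppT ppX CT CX ind.
  have [I2 <-] := pgfl_add E_hausdorff E_second_countable cK mf fK uV V0 fV c0
    ppT' ppX' CT' CX' ind'.
  apply: (eq_law_cintegral (pp_add_measurable ppT ppX) (pp_add_measurable ppT' ppX')
    law (fiber_prod_measurable V c mf) I1).
have cT z0 := pgfl_continuous E_hausdorff E_second_countable cK mf fK uV V0 fV
  z0 ppT CT.
have cT' z0 := pgfl_continuous E_hausdorff E_second_countable cK mf fK uV V0 fV
  z0 ppT' CT'.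
have phi1 : (fun x => 1 * phi x) = phi by apply/funext => x; rewrite mul1r.
(* The quotient of the two continuous nonvanishing factors preserves the order of every zero, in
   both directions. The premise of [zeros_determine] thus holds, and its conclusion is read at z =
   1. *)
have XiE : tilted_mean P Xi l = tilted_mean P' Xi' l.
  have := zd phi Bphi; move=> /(_ _)/(_ 1); rewrite phi1 !(pgfl_tilt _ cK lK)//.
  move=> XX; apply: complexI; apply: XX => z0 m; split.
    exact: (zero_of_order_quotient (cT z0) (cT' z0) (nT _ Bphi) (nT' _ Bphi) prodE).
  apply: (zero_of_order_quotient (cT' z0) (cT z0) (nT' _ Bphi) (nT _ Bphi)).
  by move=> z; rewrite prodE.
split=> //; have := prodE 1; rewrite phi1 !(pgfl_tilt _ cK lK)// -XiE.
move=> /mulIf H; apply: complexI; apply: H.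
by rewrite eq_complex /= gt_eqF// (tilted_mean_gt0 cK lK).
Qed.

End TiltedProducts.

(** * Joint laws from power transforms *)

Section PowerTransform.
Context {R : realType}.

Lemma unit_integrable d (X : measurableType d) (P : probability X R) (f : X -> R) :
  measurable_fun [set: X] f -> (forall x, 0 <= f x <= 1) ->
  P.-integrable [set: X] (EFin \o f).
Proof.
move=> mf f01; apply: (le_integrable _ _ _ (finite_measure_integrable_cst P 1 measurableT)) => //.
  exact/measurable_EFinP.
move=> x _ /=; have /andP[f0 f1] := f01 x.
by rewrite lee_fin normr1 ger0_norm.
Qed.

(** A pointwise Taylor remainder: subtracting the orders up to n leaves 0 if k is at most n, and
    otherwise g s^k, which is at most s^(n+1). *)
Lemma power_sandwich (g s : R) (k n : nat) : 0 <= g <= 1 -> 0 < s <= 1 ->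
  0 <= g * s ^+ k - \sum_(m < n.+1) g * (k == m)%:R * s ^+ m <= s ^+ n.+1.
Proof.
move=> /andP[g0 g1] /andP[s0 s1].
have sge0 m : 0 <= s ^+ m by rewrite exprn_ge0// ltW.
have [kn|nk] := ltnP k n.+1.
  rewrite (bigD1 (Ordinal kn))//= eqxx mulr1 big1 ?addr0 ?subrr ?lexx ?sge0//.
  by move=> i; rewrite -val_eqE /= eq_sym => /negPf ->; rewrite mulr0 mul0r.
rewrite big1 ?subr0; last first.
  by move=> i _; rewrite gtn_eqF ?mulr0 ?mul0r// (leq_trans (ltn_ord i)).
rewrite mulr_ge0 ?sge0//=.
apply: (@le_trans _ _ (s ^+ k)); first by rewrite ler_piMl.
by apply: ler_wiXn2l => //; exact: ltW.
Qed.

(** The event is split according to the value of k. A negative r needs its own case, since its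
    truncation 0 would wrongly admit k = 0. *)
Lemma indic_le_nat (k : nat) (r : R) :
  ((k%:R <= r)%R)%:R = \sum_(m < (if 0 <= r then (Num.truncn r).+1 else 0%N))
    (k == m)%:R :> R.
Proof.
have sumE n : \sum_(m < n) (k == m)%:R = (k < n)%N%:R :> R.
  have [kn|nk] := ltnP k n.
    rewrite (bigD1 (Ordinal kn))//= eqxx big1 ?addr0// => i.
    by rewrite -val_eqE /= eq_sym => /negPf ->.
  by rewrite big1// => i _; rewrite gtn_eqF// (leq_trans (ltn_ord i)).
case: ifPn => [r0|]; rewrite sumE; first by rewrite ltnS truncn_ge_nat.
by rewrite -ltNge => r0; rewrite lt_geF// (lt_le_trans r0).
Qed.

Section OneVariable.
Context d (X : measurableType d) (P : probability X R).
Variables (G : X -> R) (N : X -> nat).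
Hypothesis mG : measurable_fun [set: X] G.
Hypothesis G01 : forall x, 0 <= G x <= 1.
Hypothesis mN : measurable_fun [set: X] N.

Lemma atom_term_integrable m :
  P.-integrable [set: X] (EFin \o (fun x => G x * (N x == m)%:R)).
Proof.
apply: unit_integrable.
  apply: measurable_funM => //.
  exact: (measurableT_comp (f := fun n : nat => (n == m)%:R : R)).
by move=> x; case: (_ == _); rewrite ?mulr1// mulr0 lexx ler01.
Qed.

Lemma power_term_integrable s : 0 < s <= 1 ->
  P.-integrable [set: X] (EFin \o (fun x => G x * s ^+ N x)).
Proof.
move=> /andP[s0 s1]; apply: unit_integrable.
  apply: measurable_funM => //.
  exact: (measurableT_comp (f := fun n : nat => s ^+ n)).
move=> x; have /andP[g0 g1] := G01 x.
have sge0 m : 0 <= s ^+ m by rewrite exprn_ge0// ltW.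
by rewrite mulr_ge0//= mulr_ile1// exprn_ile1// ltW.
Qed.

(** The coefficients [a] are powers of s in the sandwich estimate and constantly 1 when a threshold
    event is split into levels. *)
Lemma atom_sum_integrable n (a : nat -> R) :
  P.-integrable [set: X] (EFin \o (fun x => \sum_(m < n) G x * (N x == m)%:R * a m)) /\
  Rintegral P [set: X] (fun x => \sum_(m < n) G x * (N x == m)%:R * a m) =
  \sum_(m < n) Rintegral P [set: X] (fun x => G x * (N x == m)%:R) * a m.
Proof.
have Im m : P.-integrable [set: X] (EFin \o (fun x => G x * (N x == m)%:R * a m)).
  pose t x := G x * (N x == m)%:R.
  rewrite (_ : _ \o _ = fun x => ((t x)%:E * (a m)%:E)%E)//.
  by apply: integrableZr => //; exact: atom_term_integrable.
elim: n => [|n [IHi IHe]].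
  split.
    rewrite (_ : _ \o _ = cst 0%E); first exact: integrable0.
    by apply/funext => x /=; rewrite big_ord0.
  under eq_Rintegral do rewrite big_ord0.
  by rewrite Rintegral_cst// mul0r big_ord0.
split.
  pose u x := \sum_(m < n) G x * (N x == m)%:R * a m.
  pose t x := G x * (N x == n)%:R * a n.
  rewrite (_ : _ \o _ = fun x => ((u x)%:E + (t x)%:E)%E).
    by apply: integrableD => //; exact: Im.
  by apply/funext => x /=; rewrite big_ord_recr.
under eq_Rintegral do rewrite big_ord_recr /=.
rewrite RintegralD// IHe big_ord_recr /=; congr (_ + _).
by rewrite RintegralZr//; exact: atom_term_integrable.
Qed.

Lemma power_transform_sandwich s n : 0 < s <= 1 ->
  0 <= Rintegral P [set: X] (fun x => G x * s ^+ N x) -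
    \sum_(m < n.+1) Rintegral P [set: X] (fun x => G x * (N x == m)%:R) * s ^+ m
  <= s ^+ n.+1.
Proof.
move=> s01; have [Is <-] := atom_sum_integrable n.+1 (fun m => s ^+ m).
have Ip := power_term_integrable s01.
rewrite -RintegralB// Rintegral_ge0 /=; last first.
  by move=> x _; case/andP: (power_sandwich (N x) n (G01 x) s01).
have cstE : Rintegral P [set: X] (fun=> s ^+ n.+1) = s ^+ n.+1.
  have PT : fine (P [set: X]) = 1 by rewrite probability_setT.
  by rewrite Rintegral_cst// [X in _ * X]PT mulr1.
rewrite -[leRHS]cstE; apply: le_Rintegral => //.
- pose t x := G x * s ^+ N x.
  pose u x := \sum_(m < n.+1) G x * (N x == m)%:R * s ^+ m.
  by rewrite (_ : _ \o _ = fun x => ((t x)%:E - (u x)%:E)%E)//; exact: integrableB.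
- exact: finite_measure_integrable_cst.
- by move=> x _; case/andP: (power_sandwich (N x) n (G01 x) s01).
Qed.

End OneVariable.

Lemma weight_measurable d (X : measurableType d) (I : eqType) (D : I -> Prop)
    (N : X -> I -> nat) (l l2 : seq (I * R)) :
  (forall i, D i -> measurable_fun [set: X] (N ^~ i)) ->
  (forall p, p \in l -> D p.1) -> (forall p, p \in l2 -> D p.1 /\ 0 < p.2 <= 1) ->
  let G x := (\prod_(p <- l) ((N x p.1)%:R <= p.2)%R%:R) *
    \prod_(p <- l2) p.2 ^+ N x p.1 in
  measurable_fun [set: X] G /\ forall x, 0 <= G x <= 1.
Proof.
move=> mN lD l2D G; split.
  apply: measurable_funM; apply: measurable_prod => p pl.
    apply: (measurableT_comp (f := fun n : nat => (n%:R <= p.2)%R%:R : R)) => //.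
    exact/mN/lD.
  apply: (measurableT_comp (f := fun n : nat => p.2 ^+ n)) => //.
  by apply: mN; case: (l2D p pl).
have prod01 (J : eqType) (s : seq J) (u : J -> R) :
    (forall j, j \in s -> 0 <= u j <= 1) -> 0 <= \prod_(j <- s) u j <= 1.
  move=> u01; rewrite big_seq; apply: (big_ind (fun v => (0 <= v <= 1) : bool)).
  - by rewrite ler01 lexx.
  - by move=> v w /andP[v0 v1] /andP[w0 w1]; rewrite mulr_ge0//= mulr_ile1.
  - exact: u01.
move=> x; rewrite /G.
have a01 : 0 <= (\prod_(p <- l) ((N x p.1)%:R <= p.2)%R%:R : R) <= 1.
  by apply: prod01 => p _; case: (_ <= p.2)%R; rewrite ?ler01 ?lexx.
have b01 : 0 <= \prod_(p <- l2) p.2 ^+ N x p.1 <= 1.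
  apply: prod01 => p /l2D[_ /andP[p0 p1]].
  by apply/andP; split; [apply: exprn_ge0|apply: exprn_ile1 => //]; exact: ltW.
case/andP: a01 => a0 a1; case/andP: b01 => b0 b1.
by rewrite mulr_ge0//= mulr_ile1.
Qed.

Section TwoSpaces.
Context d (X : measurableType d) (P : probability X R).
Context d' (X' : measurableType d') (P' : probability X' R).

(** The coefficients are recovered one after the other. Once the lower ones agree, both remainders
    lie between 0 and s^(n+1); dividing by s^n leaves a difference of at most s, and s is
    arbitrarily small. *)
Lemma power_transform_inj (G : X -> R) (N : X -> nat) (G' : X' -> R) (N' : X' -> nat) :
  measurable_fun [set: X] G -> (forall x, 0 <= G x <= 1) ->
  measurable_fun [set: X] N ->
  measurable_fun [set: X'] G' -> (forall x, 0 <= G' x <= 1) ->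
  measurable_fun [set: X'] N' ->
  (forall s, 0 < s <= 1 -> Rintegral P [set: X] (fun x => G x * s ^+ N x) =
    Rintegral P' [set: X'] (fun x => G' x * s ^+ N' x)) ->
  forall n, Rintegral P [set: X] (fun x => G x * (N x == n)%:R) =
    Rintegral P' [set: X'] (fun x => G' x * (N' x == n)%:R).
Proof.
move=> mG G01 mN mG' G01' mN' GN; elim/ltn_ind => n IHn.
set a := Rintegral _ _ _; set a' := Rintegral _ _ _.
suff small s : 0 < s <= 1 -> `|a - a'| <= s.
  apply/eqP; rewrite -subr_eq0 -normr_le0; apply/ler_addgt0Pr => e e0.
  rewrite add0r; have [e1|e1] := leP e 1; first by apply: small; rewrite e0.
  by apply: le_trans (ltW e1); apply: small; rewrite ltr01 lexx.
move=> s01; have /andP[s0 s1] := s01.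
have := power_transform_sandwich P mG G01 mN n s01.
have := power_transform_sandwich P' mG' G01' mN' n s01.
rewrite -GN// !big_ord_recr /= -/a -/a'.
have -> : \sum_(m < n) Rintegral P' [set: X'] (fun x => G' x * (N' x == m)%:R) * s ^+ m =
   \sum_(m < n) Rintegral P [set: X] (fun x => G x * (N x == m)%:R) * s ^+ m.
  by apply: eq_bigr => m _; rewrite -IHn.
set t := Rintegral _ _ _; set u := \sum_(_ < _) _ => /andP[l1 u1] /andP[l2 u2].
have sn0 : 0 < s ^+ n by exact: exprn_gt0.
rewrite -(ler_pM2r sn0) -exprS -{1}(gtr0_norm sn0) -normrM mulrBl ler_norml.
by apply/andP; split; lra.
Qed.

Lemma joint_law (I : eqType) (D : I -> Prop) (N : X -> I -> nat) (N' : X' -> I -> nat) :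
  (forall i, D i -> measurable_fun [set: X] (N ^~ i)) ->
  (forall i, D i -> measurable_fun [set: X'] (N' ^~ i)) ->
  (forall l : seq (I * R), (forall p, p \in l -> D p.1 /\ 0 < p.2 <= 1) ->
    Rintegral P [set: X] (fun x => \prod_(p <- l) p.2 ^+ N x p.1) =
    Rintegral P' [set: X'] (fun x => \prod_(p <- l) p.2 ^+ N' x p.1)) ->
  forall l : seq (I * R), (forall p, p \in l -> D p.1) ->
    Rintegral P [set: X] (fun x => \prod_(p <- l) ((N x p.1)%:R <= p.2)%R%:R) =
    Rintegral P' [set: X'] (fun x => \prod_(p <- l) ((N' x p.1)%:R <= p.2)%R%:R).
Proof.
move=> mN mN' NN' l lD.
(* The coordinates are converted one at a time: [l] carries the threshold indicators and [l2] the
   coordinates still in power form. Generality in [l2] lets the induction hypothesis supply the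
   transform in s of the coordinate being converted. *)
suff gen (l2 : seq (I * R)) : (forall p, p \in l2 -> D p.1 /\ 0 < p.2 <= 1) ->
    Rintegral P [set: X] (fun x => (\prod_(p <- l) ((N x p.1)%:R <= p.2)%R%:R) *
      \prod_(p <- l2) p.2 ^+ N x p.1) =
    Rintegral P' [set: X'] (fun x => (\prod_(p <- l) ((N' x p.1)%:R <= p.2)%R%:R) *
      \prod_(p <- l2) p.2 ^+ N' x p.1).
  have gen0 := gen [::].
  etransitivity; [|etransitivity; [apply: gen0|]] => //;
    by apply: eq_Rintegral => x _; rewrite big_nil mulr1.
elim: l lD l2 => [|[i r] l IHl] lD l2 l2D.
  etransitivity; [|etransitivity; [exact: (NN' l2 l2D)|]];
    by apply: eq_Rintegral => x _; rewrite big_nil mul1r.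
have Di : D i by apply: (lD (i, r)); rewrite mem_head.
have lD' p : p \in l -> D p.1 by move=> pl; apply: lD; rewrite inE pl orbT.
pose G x := (\prod_(p <- l) ((N x p.1)%:R <= p.2)%R%:R) *
  \prod_(p <- l2) p.2 ^+ N x p.1 : R.
pose G' x := (\prod_(p <- l) ((N' x p.1)%:R <= p.2)%R%:R) *
  \prod_(p <- l2) p.2 ^+ N' x p.1 : R.
pose M := if 0 <= r then (Num.truncn r).+1 else 0%N.
have [mG G01] : measurable_fun [set: X] G /\ forall x, 0 <= G x <= 1.
  exact: (weight_measurable mN).
have [mG' G01'] : measurable_fun [set: X'] G' /\ forall x, 0 <= G' x <= 1.
  exact: (weight_measurable mN').
have GE x : (\prod_(p <- (i, r) :: l) ((N x p.1)%:R <= p.2)%R%:R) *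
    \prod_(p <- l2) p.2 ^+ N x p.1 = \sum_(m < M) G x * (N x i == m)%:R * 1.
  rewrite big_cons /= indic_le_nat -mulrA mulrC mulr_sumr.
  by apply: eq_bigr => m _; rewrite mulr1.
have GE' x : (\prod_(p <- (i, r) :: l) ((N' x p.1)%:R <= p.2)%R%:R) *
    \prod_(p <- l2) p.2 ^+ N' x p.1 = \sum_(m < M) G' x * (N' x i == m)%:R * 1.
  rewrite big_cons /= indic_le_nat -mulrA mulrC mulr_sumr.
  by apply: eq_bigr => m _; rewrite mulr1.
rewrite (eq_Rintegral _ (fun x _ => GE x)) (eq_Rintegral _ (fun x _ => GE' x)).
rewrite (atom_sum_integrable P mG G01 (mN i Di) M (fun=> 1)).2.
rewrite (atom_sum_integrable P' mG' G01' (mN' i Di) M (fun=> 1)).2.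
apply: eq_bigr => m _; congr (_ * _); move: (nat_of_ord m) => {m}.
apply: power_transform_inj => //; [exact: mN|exact: mN'|move=> s s01].
have l2D' p : p \in (i, s) :: l2 -> D p.1 /\ 0 < p.2 <= 1.
  by rewrite inE => /predU1P[->|/l2D].
etransitivity; [|etransitivity; [exact: (IHl lD' _ l2D')|]];
  by apply: eq_Rintegral => x _; rewrite big_cons /= mulrCA [RHS]mulrC.
Qed.

End TwoSpaces.

End PowerTransform.

(** * Identification of the law *)

Section LawFromTiltedMeans.
Context {R : realType} {E : completePseudoMetricType R}.
Hypothesis E_hausdorff : hausdorff_space E.
Hypothesis E_second_countable : @second_countable E.
Hypothesis E_locally_compact : locally_compact [set: E].

(** By local compactness each point lies in a basic open set contained in a closed compact
    neighbourhood, hence with compact closure; finite unions of such closures exhaust [E]. *)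
Lemma compact_exhaustion : exists K : nat -> set E,
  [/\ forall n, compact (K n), forall n, K n `<=` K n.+1 &
    \bigcup_n K n = [set: E]].
Proof.
have [U [Uopen Ubase]] := countable_base E_second_countable.
pose C k := if `[< compact (closure (U k)) >] then closure (U k) else set0.
exists (fun n => \big[setU/set0]_(k < n) C k); split.
- move=> n; apply: bigsetU_compact => k _; rewrite /C.
  by case: asboolP => // _; exact: compact0.
- by move=> n x Cx; rewrite big_ord_recr /=; left.
apply/seteqP; split=> // x _; have [W + [cW clW]] := @E_locally_compact x I.
move=> xW; have xW' : nbhs x W := @filterS _ _ (nbhs_filter x) _ _ (fun y => @^~ I) xW.
have [k Ukx UkW] := Ubase x W xW'.
exists k.+1 => //; rewrite big_ord_recr /=; right; rewrite /C asboolT.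
  exact: subset_closure.
apply: (subclosed_compact _ cW); first exact: closed_closure.
have WE : W = closure W by apply/closure_id.
by rewrite [X in _ `<=` X]WE; exact: closureS.
Qed.

(** The bounds are on the extended-real mass and not on [mult], so that they remain faithful on sets
    of infinite mass. *)
Definition below (l : seq (set E * R)) : set (cfg E) :=
  [set mu | forall p, p \in l -> (mu p.1 <= p.2%:E)%E].

Definition borel_marks (l : seq (set E * R)) : Prop :=
  forall p, p \in l -> measurable (p.1 : set (Borel E)).

Definition below_sets : set (set (cfg E)) :=
  [set S | exists2 l, borel_marks l & S = below l].

Lemma below_cons p l : below (p :: l) = [set mu | (mu p.1 <= p.2%:E)%E] `&` below l.
Proof.
apply/seteqP; split=> mu.
  move=> pl; split; first by apply: pl; rewrite mem_head.
  by move=> q ql; apply: pl; rewrite inE ql orbT.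
by move=> [mup mul] q; rewrite inE => /predU1P[->|/mul].
Qed.

Lemma below_measurable l : borel_marks l ->
  measurable (below l : set (@cfg_space R E)).
Proof.
elim: l => [|p l IHl] pl.
  by rewrite (_ : below [::] = setT)//; apply/seteqP; split.
rewrite below_cons; apply: measurableI; last first.
  by apply: IHl => q ql; apply: pl; rewrite inE ql orbT.
have mp : measurable (p.1 : set (Borel E)) by apply: pl; rewrite mem_head.
have := eval_measurable mp measurableT (emeasurable_itv `]-oo, p.2%:E]).
rewrite setTI; congr measurable.
Qed.

(** Open upper rays generate the Borel sets of the extended reals, and the preimage of such a ray
    under an evaluation is the complement of a single threshold set. *)
Lemma cfg_measurable_below : @cfg_measurable R E `<=` <<s below_sets >>.
Proof.
apply: smallest_sub; first exact: smallest_sigma_algebra.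
move=> _ [A [U [mA mU ->]]].
have mev : measurable_fun [set: g_sigma_algebraType below_sets]
    (fun mu : g_sigma_algebraType below_sets => (mu : cfg E) A).
  apply: (measurability (@ErealGenOInfty.G R)).
    exact: ErealGenOInfty.measurableE.
  move=> _ [_ [r ->] <-]; rewrite setTI.
  have -> : (fun mu : cfg E => mu A) @^-1` `]r%:E, +oo[%classic =
      ~` below [:: (A, r)].
    apply/seteqP; split=> mu /=; rewrite in_itv /= andbT.
      by move=> rA /(_ (A, r)); rewrite mem_head leNgt rA => /(_ isT).
    by move=> nb; rewrite ltNge; apply/negP => muA; apply: nb => p; rewrite inE => /eqP ->.
  apply: measurableC; apply: sub_sigma_algebra; exists [:: (A, r)] => //.
  by move=> p; rewrite inE => /eqP ->.
by have := mev measurableT U mU; rewrite setTI.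
Qed.

(** Concatenating lists intersects the threshold sets, so they form a generating pi-system, which
    contains the whole space through the empty list; two probability measures equal on it
    coincide. *)
Lemma eq_in_law_below d (Omega : measurableType d) (P : probability Omega R)
    (L : Omega -> cfg E) d' (Omega' : measurableType d')
    (P' : probability Omega' R) (L' : Omega' -> cfg E) :
  point_process L -> point_process L' ->
  (forall l, borel_marks l -> P (L @^-1` below l) = P' (L' @^-1` below l)) ->
  eq_in_law P L P' L'.
Proof.
move=> ppL ppL' LL' S /cfg_measurable_below mS.
have [F FE] := mfun_of_measurable (point_process_measurable ppL).
have [F' FE'] := mfun_of_measurable (point_process_measurable ppL').
suff : distribution P F S = distribution P' F' S.
  by rewrite /distribution /pushforward FE FE'.
apply: (@g_sigma_algebra_measure_unique _ R (g_sigma_algebraType (@cfg_gen R E))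
  below_sets _ (fun=> setT) _ _
  (distribution P F) (distribution P' F')) => //.
- by move=> _ [l lb ->]; exact: below_measurable.
- by move=> _; exists [::] => //; apply/seteqP; split.
- by apply: bigcup_const; exists 0%N.
- move=> _ _ [l1 lb1 ->] [l2 lb2 ->]; exists (l1 ++ l2).
    by move=> p; rewrite mem_cat => /orP[/lb1|/lb2].
  apply/seteqP; split=> mu.
    by move=> [b1 b2] p; rewrite mem_cat => /orP[/b1|/b2].
  by move=> b; split=> p pl; apply: b; rewrite mem_cat pl ?orbT.
- move=> _ [l lb ->]; transitivity (P (L @^-1` below l)); first by rewrite -FE.
  by rewrite LL'// -FE'.
- by move=> _; rewrite -ge0_fin_numE// fin_num_measure.
Qed.

Definition restrict_marks (K : set E) (l : seq (set E * R)) :=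
  [seq (p.1 `&` K, p.2) | p <- l].

(** For each outcome the mass of a set cut by [K n] increases to its full mass, so the events
    decrease to the unrestricted one, and continuity from above applies. *)
Lemma below_restrict_cvg d (Omega : measurableType d) (P : probability Omega R)
    (L : Omega -> cfg E) (K : nat -> set E) (l : seq (set E * R)) :
  point_process L -> (forall n, compact (K n)) -> (forall n, K n `<=` K n.+1) ->
  \bigcup_n K n = [set: E] -> borel_marks l ->
  P (L @^-1` below (restrict_marks (K n) l)) @[n --> \oo] --> P (L @^-1` below l).
Proof.
move=> ppL cK incK KT lb.
have mK n : measurable (K n : set (Borel E)) by exact: compact_borel.
have mrestr n : borel_marks (restrict_marks (K n) l).
  by move=> _ /mapP[p pl ->]; apply: measurableI => //; exact: lb.
have mpre l' : borel_marks l' -> measurable (L @^-1` below l').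
  move=> /below_measurable mb; have := point_process_measurable ppL.
  by move=> /(_ measurableT _ mb); rewrite setTI.
have capE : \bigcap_n (L @^-1` below (restrict_marks (K n) l)) = L @^-1` below l.
  apply/seteqP; split=> w.
    move=> bw p pl; have [Lw_meas _ _] := point_process_counting w ppL.
    have [m mE] := is_measure_fun_measure Lw_meas.
    have mp := lb p pl.
    have mpK n : measurable (p.1 `&` K n : set (Borel E)) by exact: measurableI.
    have pE : \bigcup_n (p.1 `&` K n) = p.1 by rewrite -setI_bigcupr KT setIT.
    have cvgm : m (p.1 `&` K n) @[n --> \oo] --> m p.1.
      rewrite -{2}pE; apply: nondecreasing_cvg_mu => //.
        by apply: bigcup_measurable.
      apply/nondecreasing_seqP => n; apply/subsetPset.
      by apply: setIS; exact: incK.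
    rewrite -mE// -(cvg_lim _ cvgm)//; apply: lime_le; first exact: cvgP cvgm.
    apply: nearW => n; rewrite mE//.
    by apply: (bw n I (p.1 `&` K n, p.2)); apply/mapP; exists p.
  move=> bw n _ _ /mapP[p pl ->] /=; apply: le_trans (bw p pl).
  have [Lw_meas _ _] := point_process_counting w ppL.
  have [m mE] := is_measure_fun_measure Lw_meas.
  have mp := lb p pl.
  have mpK : measurable (p.1 `&` K n : set (Borel E)) by exact: measurableI.
  by rewrite -!mE//; apply: le_measure; rewrite ?inE.
rewrite -capE; apply: nonincreasing_cvg_mu.
- by rewrite -ge0_fin_numE// fin_num_measure//; exact: mpre.
- by move=> n; exact: mpre.
- by rewrite capE; exact: mpre.
apply/nonincreasing_seqP => n; apply/subsetPset => w bw _ /mapP[p pl ->] /=.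
have [Lw_meas _ _] := point_process_counting w ppL.
have [m mE] := is_measure_fun_measure Lw_meas.
have mp := lb p pl.
have mpK k : measurable (p.1 `&` K k : set (Borel E)) by exact: measurableI.
apply: (@le_trans _ _ (L w (p.1 `&` K n.+1))); last first.
  by apply: (bw (p.1 `&` K n.+1, p.2)); apply/mapP; exists p.
by rewrite -!mE//; apply: le_measure; rewrite ?inE//; apply: setIS.
Qed.

Lemma below_prod d (Omega : measurableType d) (P : probability Omega R)
    (L : Omega -> cfg E) (K : set E) (l : seq (set E * R)) :
  point_process L -> compact K -> compact_marks l K ->
  P (L @^-1` below l) =
  (Rintegral P [set: Omega] (fun w => \prod_(p <- l) ((mult (L w) p.1)%:R <= p.2)%R%:R))%:E.
Proof.
move=> ppL cK lK.
have mb : measurable (L @^-1` below l).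
  have /below_measurable mb : borel_marks l by move=> p /lK[].
  by have := point_process_measurable ppL measurableT mb; rewrite setTI.
have -> : (fun w => \prod_(p <- l) ((mult (L w) p.1)%:R <= p.2)%R%:R) =
    \1_(L @^-1` below l) :> (Omega -> R).
  apply/funext => w; rewrite indicE.
  have LE p : p \in l -> L w p.1 = (mult (L w) p.1)%:R%:E.
    move=> /lK[mp pK].
    exact: (counting_subset E_hausdorff (point_process_counting w ppL) cK mp pK).
  have [bw|bw] := boolP (w \in L @^-1` below l).
    rewrite big_seq big1// => p pl; move: bw; rewrite inE => /(_ p pl).
    by rewrite LE// lee_fin => ->.
  have [p pl np] : exists2 p, p \in l & ~~ (L w p.1 <= p.2%:E)%E.
    apply: contraNP bw => nex; rewrite inE => p pl.
    by apply: contrapT => /negP np; apply: nex; exists p.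
  rewrite LE// lee_fin in np.
  by rewrite (big_rem p)//= (negPf np) mul0r.
rewrite /Rintegral integral_indic// setIT fineK// fin_num_measure//.
Qed.

Lemma eq_in_law_tilted_mean d (Omega : measurableType d) (P : probability Omega R)
    (L : Omega -> cfg E) d' (Omega' : measurableType d')
    (P' : probability Omega' R) (L' : Omega' -> cfg E) :
  point_process L -> point_process L' ->
  (forall K l, compact K -> compact_marks l K -> (forall p, p \in l -> 0 < p.2) ->
    tilted_mean P L l = tilted_mean P' L' l) ->
  eq_in_law P L P' L'.
Proof.
move=> ppL ppL' LL'; apply: eq_in_law_below => // l lb.
have [K [cK incK KT]] := compact_exhaustion.
have c := below_restrict_cvg (P := P) ppL cK incK KT lb.
have c' := below_restrict_cvg (P := P') ppL' cK incK KT lb.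
rewrite -(cvg_lim _ c)// -(cvg_lim _ c')//; congr (lim (_ @ \oo)).
apply/funext => n.
have lK : compact_marks (restrict_marks (K n) l) (K n).
  move=> _ /mapP[p pl ->] /=; split; last exact: subIsetr.
  by apply: measurableI; [exact: lb|exact: compact_borel].
rewrite !(below_prod _ _ (cK n) lK)//; congr (_%:E).
(* Only for Borel sets inside the fixed compact [K n] are the generating functions known to agree,
   so [joint_law] is applied with the indices limited to these. *)
pose D (A : set E) := measurable (A : set (Borel E)) /\ A `<=` K n.
have mN d1 (X : measurableType d1) (M : X -> cfg E) : point_process M ->
    forall A, D A -> measurable_fun [set: X] (fun w => mult (M w) A).
  move=> ppM A [mA _].
  exact: (measurableT_comp (mult_measurable mA) (point_process_measurable ppM)).
apply: (joint_law (D := D) (N := fun w A => mult (L w) A)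
  (N' := fun w A => mult (L' w) A)).
- exact: mN.
- exact: mN.
- move=> l' l'D; apply: (LL' (K n)) => // p /l'D; first by case.
  by move=> [_ /andP[]].
- by move=> p /lK.
Qed.

End LawFromTiltedMeans.

Unset Implicit Arguments.

Theorem theorem2p5 (R : realType) (E : completePseudoMetricType R)
  (E_hausdorff : hausdorff_space E)
  (E_second_countable : @second_countable E)
  (E_locally_compact : locally_compact [set: E])
  (d : measure_display) (Omega : measurableType d) (P : probability Omega R)
  (Theta Xi : Omega -> cfg E)
  (d' : measure_display) (Omega' : measurableType d') (P' : probability Omega' R)
  (Theta' Xi' : Omega' -> cfg E) :
  point_process Theta -> point_process Xi -> pp_indep P Theta Xi ->
  point_process Theta' -> point_process Xi' -> pp_indep P' Theta' Xi' ->
  class_C_nonvanishing P Theta -> class_C_nonvanishing P' Theta' ->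
  class_C P Xi -> class_C P' Xi' ->
  zeros_determine P Xi P' Xi' ->
  eq_in_law P (pp_add Theta Xi) P' (pp_add Theta' Xi') ->
  eq_in_law P Theta P' Theta' /\ eq_in_law P Xi P' Xi'.
Proof.
move=> ppT ppX ind ppT' ppX' ind' nT nT' CX CX' zd law.
have key := superposition_tilted_mean E_hausdorff E_second_countable
  ppT ppX ind ppT' ppX' ind' nT nT' CX CX' zd law.
by split; apply: eq_in_law_tilted_mean => // K l cK lK l0; case: (key K l cK lK l0).
Qed.
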